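(* Let $n\ge 2$ and $m\ge 2n+1$ be coprime integers, and let $c=(n-1)(m-1)$. There is a dense Zariski open subset $U$ of $\mathbb C^{c-m}$ such that if $(a_m,\dots,a_{c-1})\in U$, then $\Gamma_{(a_m,\dots,a_{c-1})}=\Gamma(n,m)$.
   Context: For $a_m\ne0$, the plane curve $x=t^n,\ y=\sum_{i\ge m}a_it^i$ has as conormal the Legendrian curve (for the contact form $dy-p\,dx$) parametrized by $x=t^n,\ y=\sum_{i\ge m}a_it^i,\ p=\sum_{i\ge m}\frac in a_it^{i-n}$. The semigroup of this space curve is the set of orders in $t$ of the nonzero series obtained by substituting this parametrization into elements of $\mathbb C\{x,y,p\}$. It depends only on $(a_m,\dots,a_{c-1})$, where $c=(n-1)(m-1)$ is the conductor of the semigroup $\langle n,m\rangle$ of the plane curve (the smallest integer such that all $l\ge c$ lie in the semigroup), and is denoted $\Gamma_{(a_m,\dots,a_{c-1})}$. Since $a_m\ne 0$ is assumed throughout, points of $U$ are understood to satisfy $a_m\neq0$. Denote by $\langle k_1,\dots,k_r\rangle$ the submonoid of $(\mathbb N,+)$ generated by $k_1,\dots,k_r$. The semigroup $\Gamma(n,m)$ is defined as follows. Set $\Gamma_c=\langle n\rangle\cup\{c,c+1,\dots\}$. Suppose $\Gamma_j$ is defined, with $j=c$ (the start) or with some $j\in\langle n,m-n\rangle\setminus\Gamma_c$, $j\ge m$. Let $i$ be the largest element of $\langle n,m-n\rangle\setminus\Gamma_j$. Let $\sharp_i$ be the minimum of the number of monomials of $\mathbb C[x,y,p]$ of valuation $i$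 (where $x,y,p$ have valuations $n,m,m-n$) and the cardinality of $\{i,i+1,\dots\}\setminus\Gamma_j$. Let $\omega_i$ be the $\sharp_i$-th element (in increasing order) of $\{i,i+1,\dots\}\setminus\Gamma_j$. Set $\tau_i=\{i,i+1,\dots,\omega_i\}\setminus\langle n\rangle$ and $\Gamma_i=\tau_i\cup\Gamma_j$. The process ends with $i=m-n$, and $\Gamma(n,m):=\Gamma_{m-n}$. *)

(* Defs.v *)
From HB Require Import structures.
From mathcomp Require Import all_boot all_order all_algebra.
From mathcomp Require Import boolp classical_sets reals ereal esum.
From mathcomp Require Import complex.
From mathcomp Require mpoly.

Set Implicit Arguments.
Unset Strict Implicit.
Unset Printing Implicit Defensive.

Import Order.TTheory GRing.Theory Num.Theory.
Local Open Scope classical_set_scope.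
Local Open Scope ring_scope.

(* The complex numbers are R[i] for R : realType. *)

(* The affine space K^N is 'I_N -> K, with its Zariski topology. *)
Definition zariski_closed (K : fieldType) (N : nat) (Z : set ('I_N -> K)) : Prop :=
  exists S : set (mpoly.mpoly N K),
    Z = [set u | forall q, S q -> mpoly.meval u q = 0].

Definition zariski_open (K : fieldType) (N : nat) (U : set ('I_N -> K)) : Prop :=
  zariski_closed (~` U).

Definition zariski_dense (K : fieldType) (N : nat) (U : set ('I_N -> K)) : Prop :=
  forall V : set ('I_N -> K), zariski_open V -> V !=set0 -> U `&` V !=set0.

(* Power series are given by their coefficients: [f k] is the coefficient of
   t^k, and [f a b e] that of x^a y^b p^e. A series is convergent when it
   converges absolutely on some polydisc of positive radius. *)
Definition convergent1 (R : realType) (f : nat -> R[i]) : Prop :=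
  exists2 r : R, 0 < r &
    summable [set: nat] (fun k => (ComplexField.Normc.normc (f k) * r ^+ k)%:E).

Definition convergent3 (R : realType) (f : nat -> nat -> nat -> R[i]) : Prop :=
  exists2 r : R, 0 < r &
    summable [set: nat * nat * nat]
      (fun v => (ComplexField.Normc.normc (f v.1.1 v.1.2 v.2)
                 * r ^+ (v.1.1 + v.1.2 + v.2))%:E).

Definition psmul (K : fieldType) (f g : nat -> K) : nat -> K :=
  fun k => \sum_(i < k.+1) f i * g (k - i)%N.

Definition psexp (K : fieldType) (f : nat -> K) (d : nat) : nat -> K :=
  iter d (psmul f) (fun k => (k == 0%N)%:R).

(* f(x(t), y(t), p(t)), for x, y, p without constant term. Then x^a y^b p^e
   has order at least a + b + e, so only a, b, e <= k contribute to the
   coefficient of t^k. *)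
Definition pssubst (K : fieldType) (f : nat -> nat -> nat -> K)
    (x y p : nat -> K) : nat -> K :=
  fun k => \sum_(a < k.+1) \sum_(b < k.+1) \sum_(e < k.+1)
    f a b e * psmul (psmul (psexp x a) (psexp y b)) (psexp p e) k.

Definition has_order (K : fieldType) (g : nat -> K) (l : nat) : Prop :=
  g l != 0 /\ forall k, (k < l)%N -> g k = 0.

(* The conormal of x = t^n, y = \sum_(i >= m) a_i t^i; the values a_i with
   i < m are ignored. *)
Definition curve_x (K : fieldType) (n : nat) : nat -> K :=
  fun k => (k == n)%:R.

Definition curve_y (K : fieldType) (m : nat) (a : nat -> K) : nat -> K :=
  fun k => if (m <= k)%N then a k else 0.

(* The coefficient of t^k comes from the summand i = k + n. *)
Definition curve_p (K : fieldType) (n m : nat) (a : nat -> K) : nat -> K :=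
  fun k => if (m <= k + n)%N then (k + n)%:R / n%:R * a (k + n)%N else 0.

Definition legendrian_semigroup (R : realType) (n m : nat) (a : nat -> R[i]) :
    set nat :=
  [set l | exists2 f : nat -> nat -> nat -> R[i], convergent3 f &
     has_order (pssubst f (curve_x _ n) (curve_y m a) (curve_p n m a)) l].

Local Open Scope nat_scope.

Definition conductor (n m : nat) : nat := (n - 1) * (m - 1).

(* Membership in the submonoid <n, k>. The bounds on the coefficients are
   harmless for n, k > 0. *)
Definition in_monoid2 (n k : nat) : pred nat := fun l =>
  [exists a : 'I_l.+1, exists b : 'I_l.+1, l == a * n + b * k].

(* The number of x^a y^b p^e with a n + b m + e (m - n) = i, for n, m, m - n > 0. *)
Definition num_monomials (n m i : nat) : nat :=
  #|[set v : 'I_i.+1 * 'I_i.+1 * 'I_i.+1 |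
      v.1.1 * n + v.1.2 * m + v.2 * (m - n) == i]|.

Definition Gamma_init (n m : nat) : pred nat :=
  fun k => (n %| k) || (conductor n m <= k).

(* One step G = Gamma_j |-> Gamma_i. Every G met contains {c, c+1, ...}, so
   the complements of G are enumerated, in increasing order, below c. Once
   <n, m-n> is contained in G the process has ended and G is left unchanged. *)
Definition Gamma_step (n m : nat) (G : pred nat) : pred nat :=
  let c := conductor n m in
  let rest := [seq k <- iota 0 c | in_monoid2 n (m - n) k && ~~ G k] in
  if nilp rest then G else
  let i := last 0 rest in
  let gaps := [seq k <- iota i (c - i) | ~~ G k] in
  let sharp := minn (num_monomials n m i) (size gaps) in
  let omega := nth 0 gaps sharp.-1 in
  fun k => ((i <= k <= omega) && ~~ (n %| k)) || G k.

(* The successive i are < c and strictly decreasing, so c steps reach the end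
   of the process, whose last effective step is i = m - n. *)
Definition Gamma (n m : nat) : pred nat :=
  iter (conductor n m) (Gamma_step n m) (Gamma_init n m).

(* Main.v *)
Require Import Defs.
From HB Require Import structures.
From mathcomp Require Import all_boot all_order all_algebra.
From mathcomp Require Import boolp classical_sets reals ereal esum.
From mathcomp Require Import complex.
From mathcomp Require Import cardinality fsbigop.
From mathcomp Require Import zify ring.
From mathcomp Require Import -(notations) mpoly.
Import Order.TTheory GRing.Theory Num.Theory.

(** Let I_i be the span of the monomials x^a y^b p^e of valuation at least
    i, and N_i the set of the orders of the series obtained from I_i on the
    curve. The claim is that, for generic coefficients, N_i arises from
    N_(i+1) as in the process: if k monomials have valuation i, the first k
    gaps of N_(i+1) from i on are added, or all the gaps if there are fewer.
    Enlarging a space by k generators adds at most k orders. So it is enough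
    that, generically, a gap g >= i stays a gap of N_i only if k new orders
    occur below g, that is, only if no element of I_i with a monomial of
    valuation i gives O(t^g).

    This is [layer_vanish], proved by deforming the curve. Take coefficients
    in a domain with derivations D_j = d/da_(m+j), and rescale p by n. The
    monomials of valuation i have a common degree in (y, p), so the initial
    form of f in I_i amounts to a polynomial in p/y, whose value at p/y = m
    is, up to a power of a_m, the coefficient of t^i in the series of f.
    Suppose that g is a gap, that f gives O(t^g) and has a nonzero initial
    form, and that this form vanishes at m to the least possible order. The
    order d is positive, and the initial form of p df/dp vanishes to order d
    - 1 only, so p df/dp does not give O(t^g). Let e < g be the least degree
    in which y df/dy or p df/dp has a nonzero coefficient, and let u, v be
    these coefficients. As g is a gap, f gives O(t^(g+1)), and applying D_j
    to this shows that the series of D_j f starts at t^(e+j) with a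
    coefficient proportional to m u + (m+j) v ([variation_lead]). For j = g
    - e this must vanish, g being a gap; hence it does not vanish for j < g
    - e. The initial form of D_j f still vanishes to order d at m, so
    multiples of the D_j f cancel the series of p df/dp degree by degree up
    to t^g without changing the vanishing order d - 1 ([eliminate]), against
    the choice of d.

    The ranks of the truncated coefficient matrices over the field of
    rational functions then give the rule for N_i ([order_in_step]), and
    clearing denominators shows that these ranks, hence the orders, are the
    same for all coefficients outside a hypersurface
    ([order_in_specialize]). All series are truncated at the conductor T of
    <n, m-n>: every l >= T is the order of some x^a p^e, while below T only
    a_m, ..., a_(c-1) matter because T + n <= c, and valuations below T
    determine the degree in (y, p). Finally [Gamma_by_layers] turns the
    process, which jumps from gap to gap, into the same rule applied to
    every valuation in turn. *)

Set Implicit Arguments.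
Unset Strict Implicit.
Unset Printing Implicit Defensive.

(** * The process, one valuation at a time *)

Section Monomials.
Local Open Scope nat_scope.
Variables (n m : nat).
Hypotheses (n_gt0 : 0 < n) (n_lt_m : n < m).

Lemma in_monoid2P i :
  reflect (exists a b, i = a * n + b * (m - n)) (in_monoid2 n (m - n) i).
Proof.
apply: (iffP existsP) => [[a /existsP[b /eqP->]]|[a [b def_i]]].
  by exists a, b.
have ha : a < i.+1 by nia.
have hb : b < i.+1 by nia.
by exists (Ordinal ha); apply/existsP; exists (Ordinal hb); apply/eqP.
Qed.

Lemma num_monomialsE i : num_monomials n m i =
  #|[pred v : 'I_i.+1 * 'I_i.+1 * 'I_i.+1 |
      v.1.1 * n + v.1.2 * m + v.2 * (m - n) == i]|.
Proof.
apply: eq_card => v; rewrite inE; apply/idP/idP; first by rewrite in_setE.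
by move=> h; rewrite in_setE.
Qed.

Lemma num_monomials_gt0 i : (0 < num_monomials n m i) = in_monoid2 n (m - n) i.
Proof.
rewrite num_monomialsE; apply/card_gt0P/in_monoid2P => [[[[a b] e]]|[a [b def_i]]].
  rewrite inE /= => /eqP <-; exists (a + b), (b + e); nia.
have ha : a < i.+1 by nia.
have hb : b < i.+1 by nia.
exists (Ordinal ha, ord0, Ordinal hb); rewrite inE /=; apply/eqP; lia.
Qed.

End Monomials.

(** The sets [N i] stand for the orders that monomials of valuation at least
    [i] produce, together with all integers from the conductor on. *)
Section Combinatorics.
Local Open Scope nat_scope.
Variables (n m c : nat) (N : nat -> pred nat).
Hypothesis c_def : conductor n m = c.
Hypotheses (n_gt0 : 0 < n) (n_lt_m : n < m).
Hypothesis stage_top : forall k, N c k = (c <= k).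
Hypothesis stage_step : forall i k, i < c ->
  N i k = N i.+1 k ||
    (i <= k) && (count (predC (N i.+1)) (iota i (k - i)) < num_monomials n m i).
Hypothesis stage_mult : forall i k, i < c -> n %| i -> N i k = (k == i) || N i.+1 k.

Lemma downward_ind (P : nat -> Prop) :
  P c -> (forall i, i < c -> P i.+1 -> P i) -> forall i, i <= c -> P i.
Proof.
move=> Pc Pstep i le_ic.
have: forall d, d <= c -> P (c - d).
  elim=> [|d IHd] lt_dc; first by rewrite subn0.
  by apply: Pstep; [lia | rewrite subnSK //; apply: IHd; lia].
by move/(_ (c - i)); rewrite subKn // leq_subr; apply.
Qed.

Lemma stage_ge i k : i <= c -> N i k -> i <= k.
Proof.
move=> le_ic; move: i le_ic k; apply: downward_ind => [k|i lt_ic IHi k].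
  by rewrite stage_top.
by rewrite stage_step // => /orP[/IHi/ltnW|/andP[]].
Qed.

Lemma stage_skip i k : i < c -> ~~ in_monoid2 n (m - n) i -> N i k = N i.+1 k.
Proof.
move=> lt_ic; rewrite -num_monomials_gt0 // -eqn0Ngt => /eqP k0.
by rewrite stage_step // k0 ltn0 andbF orbF.
Qed.

(* The process starts with all the multiples of n, whereas N i only contains
   those that are at least i. *)
Let C i k := (n %| k) || N i k.

Lemma process_skip i k : i < c -> (n %| i) || ~~ in_monoid2 n (m - n) i ->
  C i k = C i.+1 k.
Proof.
move=> lt_ic /orP[ni|h]; rewrite /C; last by rewrite stage_skip.
by rewrite stage_mult //; case: eqP => // ->; rewrite ni.
Qed.

Lemma process_skips i j k : i <= j -> j <= c ->
  (forall l, i <= l < j -> (n %| l) || ~~ in_monoid2 n (m - n) l) ->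
  C i k = C j k.
Proof.
move=> le_ij; rewrite -(subnK le_ij); elim: (j - i) => [|d IHd] hj h; first by [].
rewrite IHd; last 2 first.
- lia.
- by move=> l hl; apply: h; lia.
by rewrite addSn process_skip //; apply: h; lia.
Qed.

Lemma stage_multiple i k : i <= c -> i <= k -> n %| k -> N i k.
Proof.
move=> le_ic; move: i le_ic k; apply: downward_ind => [k|i lt_ic IHi k].
  by rewrite stage_top.
rewrite leq_eqVlt => /orP[/eqP<-|lt_ik] nk; first by rewrite stage_mult // eqxx.
by rewrite stage_step // IHi.
Qed.

Lemma stage_above i k : i <= c -> c <= k -> N i k.
Proof.
move=> le_ic le_ck; move: i le_ic; apply: downward_ind => [|i lt_ic IHi].
  by rewrite stage_top.
by rewrite stage_step // IHi.
Qed.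

(** The process selects gaps by their position in a list; here this position
    becomes a number of smaller gaps. *)
Lemma sorted_index_count (s : seq nat) k : sorted ltn s -> k \in s ->
  index k s = count (fun l => l < k) s.
Proof.
elim: s => //= x s IHs; rewrite inE => hs.
have xs : all (fun y => x < y) s by apply: order_path_min hs; exact: ltn_trans.
case: eqP => [->|ne] /=; last first.
  rewrite eq_sym (introF eqP ne) /= => ks.
  rewrite (allP xs _ ks) add1n IHs //; exact: path_sorted hs.
move=> _; rewrite eqxx ltnn; apply/esym/eqP.
rewrite -leqn0 leqNgt -has_count -all_predC.
by apply: sub_all xs => y /= ; rewrite -leqNgt => /ltnW.
Qed.

(** A gap [k] is at most the [sharp]-th gap exactly when fewer than [sharp]
    gaps precede it, and bounding [sharp] by the number of gaps loses nothing
    because [k] is one of them. *)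
Lemma process_step (G : pred nat) i : G =1 C i.+1 -> i < c -> ~~ G i ->
  in_monoid2 n (m - n) i ->
  let gaps := [seq k <- iota i (c - i) | ~~ G k] in
  let sharp := minn (num_monomials n m i) (size gaps) in
  let omega := nth 0 gaps sharp.-1 in
  (fun k => ((i <= k <= omega) && ~~ (n %| k)) || G k) =1 C i.
Proof.
move=> GC lt_ic nGi hi gaps sharp omega k.
have ni : ~~ (n %| i) by move: nGi; rewrite GC /C negb_or => /andP[].
have gP l : (l \in gaps) = ~~ G l && (i <= l < c).
  by rewrite mem_filter mem_iota subnKC // ltnW.
have sg : sorted ltn gaps.
  by apply: sorted_filter; [exact: ltn_trans | exact: iota_ltn_sorted].
have size_gt0 : 0 < size gaps.
  by rewrite -has_predT; apply/hasP; exists i; rewrite // gP nGi leqnn lt_ic.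
have num_gt0 : 0 < num_monomials n m i by rewrite num_monomials_gt0 //.
case Gk: (G k).
  rewrite orbT; move: Gk; rewrite GC /C => /orP[->//|h].
  by rewrite stage_step // h orbT.
move: (Gk); rewrite GC /C orbF => /negbT; rewrite negb_or => /andP[nk nNk].
rewrite (negbTE nk) /= andbT stage_step // (negbTE nNk) /=.
case: (leqP i k) => //= le_ik.
have lt_kc : k < c.
  by rewrite ltnNge; apply: contraNN nNk; exact: stage_above.
have kg : k \in gaps by rewrite gP Gk le_ik lt_kc.
have -> : count (predC (N i.+1)) (iota i (k - i)) = index k gaps.
  rewrite sorted_index_count // count_filter.
  rewrite -(subnKC (_ : k - i <= c - i)); last lia.
  rewrite iotaD count_cat [X in _ + X](_ : _ = 0) ?addn0; last first.
    apply/eqP; rewrite -leqn0 leqNgt -has_count; apply/hasPn => l.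
    by rewrite mem_iota /=; lia.
  apply: eq_in_count => l; rewrite mem_iota subnKC // => /andP[h1 h2] /=.
  rewrite h2 /= GC /C negb_or; case nl: (n %| l) => //=.
  have h3 : l != i by apply: contraNN ni => /eqP <-; rewrite nl.
  by rewrite stage_multiple //; lia.
have kidx := index_mem k gaps; rewrite kg in kidx.
rewrite -{1}(nth_index 0 kg) /omega.
have sharp_lt : sharp.-1 < size gaps by rewrite /sharp; lia.
rewrite (_ : (nth 0 gaps (index k gaps) <= _) = (index k gaps <= sharp.-1)).
  move: kidx num_gt0; rewrite /sharp.
  move: (index k gaps) (size gaps) (num_monomials n m i) => a b d; lia.
have := sorted_ltn_nth ltn_trans 0 sg => sgn.
case: (leqP (index k gaps) sharp.-1) => h.
  move: h; rewrite leq_eqVlt => /orP[/eqP->|h]; first exact: leqnn.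
  by rewrite ltnW //; apply: sgn.
by apply/negbTE; rewrite -ltnNge; apply: sgn.
Qed.

(** The valuations that the process passes over are multiples of n or carry no
    monomial, so the set [C] is the same before and after them. *)
Lemma Gamma_stepP (G : pred nat) i : i <= c -> G =1 C i ->
  Gamma_step n m G =1 C 0 \/
  exists2 j, j < i & Gamma_step n m G =1 C j.
Proof.
move=> le_ic GC; rewrite /Gamma_step c_def.
set rest := [seq k <- _ | _].
have restP k : (k \in rest) = [&& in_monoid2 n (m - n) k, ~~ G k & k < c].
  by rewrite mem_filter mem_iota add0n /= andbA.
case: nilP => [rest0|/eqP rest_n0]; [left|right].
  move=> k; rewrite GC; apply/esym/process_skips => // l /andP[_ lt_li].
  rewrite orbC -implybE; apply/implyP => hl.
  have := restP l; rewrite rest0 in_nil hl /= GC.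
  rewrite (_ : (l < c)) ?andbT; last lia.
  by move/esym/negbFE; rewrite /C => /orP[//|/(stage_ge le_ic)]; lia.
have rest_gt0 : 0 < size rest by rewrite lt0n size_eq0.
set i' := last 0 rest.
have : i' \in rest by rewrite /i'; case: (rest) rest_gt0 => //= x s _; exact: mem_last.
rewrite restP => /and3P[i'mon nGi' lt_i'c].
have i'max k : k \in rest -> k <= i'.
  move=> kr; rewrite /i' -nth_last -(nth_index 0 kr).
  have sr : sorted ltn rest.
    by apply: sorted_filter; [exact: ltn_trans | exact: iota_ltn_sorted].
  have := index_mem k rest; rewrite kr => h.
  have : index k rest <= (size rest).-1 by rewrite -ltnS prednK.
  rewrite leq_eqVlt => /orP[/eqP->//|h2]; apply: ltnW.
  by apply: (sorted_ltn_nth ltn_trans 0 sr) => //; rewrite inE ltn_predL.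
have lt_i'i : i' < i.
  rewrite ltnNge; apply: contraNN nGi' => le_ii'; rewrite GC.
  have hskip l : i <= l < c -> in_monoid2 n (m - n) l -> N i l.
    move=> hl lmon; move: i le_ic {lt_i'c le_ii' GC} hl.
    apply: downward_ind => [|i lt_ic IHi] hl.
      by rewrite stage_top; lia.
    rewrite stage_step //; case: (eqVneq l i) => [el|nel].
      by rewrite el leqnn subnn /= num_monomials_gt0 // -el lmon orbT.
    by rewrite IHi //; lia.
  by rewrite /C hskip ?orbT // le_ii'.
exists i' => //; apply: process_step => // k.
rewrite GC; apply/esym/process_skips => // l /andP[hl1 hl2].
rewrite orbC -implybE; apply/implyP => hl.
have := contraNN (i'max l) (_ : ~~ (l <= i')); rewrite -ltnNge => /(_ hl1).
rewrite restP hl /= (_ : l < c) ?andbT ?negbK ?GC; last lia.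
by rewrite /C => /orP[//|/(stage_ge le_ic)]; lia.
Qed.

Lemma Gamma_by_layers k : Gamma n m k = N 0 k.
Proof.
suff h : Gamma n m =1 C 0.
  rewrite h /C; case nk: (n %| k) => //=.
  by rewrite stage_multiple.
rewrite /Gamma c_def.
suff : forall t, exists2 i, i <= c - t &
    iter t (Gamma_step n m) (Gamma_init n m) =1 C i.
  by case/(_ c) => i; rewrite subnn leqn0 => /eqP->.
elim=> [|t [i le_i IHt]].
  exists c; first by rewrite subn0.
  by move=> l; rewrite /C stage_top /Gamma_init c_def.
have le_ic : i <= c by lia.
case: (Gamma_stepP le_ic IHt) => [h|[j lt_ji h]].
  by exists 0.
by exists j => //; lia.
Qed.

End Combinatorics.

(** * Orders of a filtered family of series *)

Section Orders.
Local Open Scope ring_scope.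
Variables (A : nzRingType) (V : finType) (w : V -> nat) (phi : V -> nat -> A).

(** A family of series [phi], given by coefficients, is filtered by the weight
    [w] of its indices. *)
Definition comb (f : V -> A) (k : nat) : A := \sum_v f v * phi v k.

Definition order_in (i g : nat) : Prop :=
  exists f : V -> A, [/\ forall v, (w v < i)%N -> f v = 0,
    forall k, (k < g)%N -> comb f k = 0 & comb f g != 0].

Lemma order_in_mono i g : order_in i.+1 g -> order_in i g.
Proof. by case=> f [h1 h2 h3]; exists f; split=> // v h; apply: h1; lia. Qed.

Hypothesis phi_low : forall v k, (k < w v)%N -> phi v k = 0.

Lemma order_in_ge i g : order_in i g -> (i <= g)%N.
Proof.
case=> f [h1 _]; rewrite leqNgt; apply: contraNN => lt_gi.
rewrite /comb big1 ?eqxx // => v _; case: (ltnP (w v) i) => h.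
  by rewrite h1 ?mul0r.
by rewrite phi_low ?mulr0 //; lia.
Qed.

End Orders.

Section LinearAlgebra.
Local Open Scope ring_scope.
Variables (F : fieldType) (V : finType) (w : V -> nat) (phi : V -> nat -> F).
Variable (T : nat).
Hypothesis phi_low : forall v k, (k < w v)%N -> phi v k = 0.

(** Ranks are compared through left kernels: these consist of the relations
    between the series, which are what the orders speak of. *)
Lemma rank_le_ker p q r (A : 'M[F]_(p, q)) (B : 'M[F]_(p, r)) :
  (forall u : 'rV_p, u *m A = 0 -> u *m B = 0) -> (\rank B <= \rank A)%N.
Proof.
move=> h; have: (kermx A <= kermx B)%MS.
  by apply/rV_subP => u /sub_kermxP /h /sub_kermxP.
move/mxrankS; rewrite !mxrank_ker.
have := rank_leq_row A; have := rank_leq_row B; lia.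
Qed.

Lemma rank_lt_ker p q r (A : 'M[F]_(p, q)) (B : 'M[F]_(p, r)) (u0 : 'rV_p) :
  (forall u : 'rV_p, u *m A = 0 -> u *m B = 0) ->
  u0 *m B = 0 -> u0 *m A != 0 -> (\rank B < \rank A)%N.
Proof.
move=> h hB hA; have: (kermx A < kermx B)%MS.
  apply/andP; split.
    by apply/rV_subP => u /sub_kermxP /h /sub_kermxP.
  apply: contraNN hA => hBA; apply/eqP/sub_kermxP.
  by apply: submx_trans hBA; exact/sub_kermxP.
move/rank_ltmx; rewrite !mxrank_ker.
have := rank_leq_row A; have := rank_leq_row B; lia.
Qed.

(** Rows of small weight and columns beyond the truncation are set to 0 rather
    than removed, so that all these matrices have the same size. *)
Definition coef_mx (i g : nat) : 'M[F]_(#|V|, T) :=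
  \matrix_(r, k) if (i <= w (enum_val r))%N && (k < g)%N
                 then phi (enum_val r) k else 0.

Definition coef_rank i g := \rank (coef_mx i g).

Definition fun_of_row (i : nat) (u : 'rV[F]_#|V|) (v : V) : F :=
  if (i <= w v)%N then u 0 (enum_rank v) else 0.

Lemma fun_of_row_low i u v : (w v < i)%N -> fun_of_row i u v = 0.
Proof. by rewrite /fun_of_row ltnNge; case: ifP. Qed.

Lemma mul_coef_mx i g (u : 'rV_#|V|) (k : 'I_T) :
  (u *m coef_mx i g) 0 k = if (k < g)%N then comb phi (fun_of_row i u) k else 0.
Proof.
rewrite mxE (reindex _ (onW_bij _ (@enum_rank_bij V))) /=.
case: ltnP => hk; last first.
  by rewrite big1 // => v _; rewrite mxE ltnNge hk andbF mulr0.
apply: eq_bigr => v _; rewrite mxE enum_rankK hk andbT /fun_of_row.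
by case: leqP => h; rewrite ?mulr0 ?mul0r.
Qed.

Lemma ker_coef_mxP i g (u : 'rV_#|V|) : (g <= T)%N ->
  u *m coef_mx i g = 0 <->
  (forall k, (k < g)%N -> comb phi (fun_of_row i u) k = 0).
Proof.
move=> le_gT; split=> [h k lt_kg|h].
  have lt_kT := leq_trans lt_kg le_gT.
  by have := mul_coef_mx i g u (Ordinal lt_kT); rewrite h mxE /= lt_kg.
by apply/rowP => k; rewrite mul_coef_mx mxE; case: ifP => // /h.
Qed.

Lemma fun_of_rowK i f : (forall v, (w v < i)%N -> f v = 0) ->
  fun_of_row i (\row_r f (enum_val r)) =1 f.
Proof.
move=> hf v; rewrite /fun_of_row mxE enum_rankK.
by case: leqP => // /hf.
Qed.

Lemma eq_comb f f' k : f =1 f' -> comb phi f k = comb phi f' k.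
Proof. by move=> h; apply: eq_bigr => v _; rewrite h. Qed.

Lemma coef_ker_incr i g (u : 'rV_#|V|) : (g < T)%N ->
  u *m coef_mx i g.+1 = 0 -> u *m coef_mx i g = 0.
Proof.
move=> lt_gT /(ker_coef_mxP _ _ lt_gT) h.
by apply/(ker_coef_mxP _ _ (ltnW lt_gT)) => k hk; apply: h; lia.
Qed.

(** The number of orders below [g] is the rank of the first [g] columns: this
    lemma and the next one count the contribution of one more column. *)
Lemma coef_rank_jump i g : (g < T)%N -> order_in w phi i g ->
  coef_rank i g.+1 = (coef_rank i g).+1.
Proof.
move=> lt_gT [f [h1 h2 h3]]; apply/eqP; rewrite /coef_rank eqn_leq; apply/andP; split.
  have -> : coef_mx i g.+1 = coef_mx i g +
      col (Ordinal lt_gT) (coef_mx i g.+1) *m delta_mx 0 (Ordinal lt_gT).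
    apply/matrixP => r k; rewrite !mxE big_ord1 !mxE !eqxx /= ltnS leqnn andbT.
    rewrite (_ : (k == Ordinal lt_gT) = (k == g :> nat)) //.
    rewrite [(k <= g)%N]leq_eqVlt; case: (eqVneq (k : nat) g) => [->|] /=.
      by rewrite ltnn andbF andbT mulr1 add0r.
    by rewrite mulr0 addr0.
  apply: leq_trans (mxrank_add _ _) _; rewrite -[X in (_ <= X)%N]addn1 leq_add2l.
  by apply: leq_trans (mxrankM_maxl _ _) _; exact: rank_leq_col.
apply: (@rank_lt_ker _ _ _ _ _ (\row_r f (enum_val r))).
- by move=> u; apply: coef_ker_incr.
- apply/(ker_coef_mxP _ _ (ltnW lt_gT)) => k hk.
  by rewrite (eq_comb _ (f' := f)) ?h2 //; exact: fun_of_rowK.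
apply: contraNneq h3 => /(ker_coef_mxP _ _ lt_gT) hu.
by rewrite -(eq_comb g (fun_of_rowK h1)) hu.
Qed.

Lemma coef_rank_stay i g : (g < T)%N -> ~ order_in w phi i g ->
  coef_rank i g.+1 = coef_rank i g.
Proof.
move=> lt_gT hN; apply/eqP; rewrite eqn_leq; apply/andP; split; last first.
  by apply: rank_le_ker => u; apply: coef_ker_incr.
apply: rank_le_ker => u /(ker_coef_mxP _ _ (ltnW lt_gT)) h.
apply/(ker_coef_mxP _ _ lt_gT) => k; rewrite ltnS leq_eqVlt.
case/orP => [/eqP->|/h//].
case: (eqVneq (comb phi (fun_of_row i u) g) 0) => // ne0; case: hN.
by exists (fun_of_row i u); split=> // v; exact: fun_of_row_low.
Qed.

Lemma coef_rank0 i : coef_rank i i = 0%N.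
Proof.
rewrite /coef_rank (_ : coef_mx i i = 0) ?mxrank0 //.
apply/matrixP => r k; rewrite !mxE; case: ifP => // /andP[h1 h2].
by rewrite phi_low //; lia.
Qed.

Lemma coef_rankS0 i : coef_rank i.+1 i = 0%N.
Proof.
rewrite /coef_rank (_ : coef_mx i.+1 i = 0) ?mxrank0 //.
apply/matrixP => r k; rewrite !mxE; case: ifP => // /andP[h1 h2].
by rewrite phi_low //; lia.
Qed.

(** Comparison of the spans of weights at least [i] and at least [i + 1]. *)
Section Layer.
Variable i : nat.
Let P := [pred r : 'I_#|V| | w (enum_val r) == i].
(* The rows of weight i: left multiplication by E extracts them. *)
Let E : 'M[F]_(#|P|, #|V|) := \matrix_(a, r) (r == enum_val a)%:R.

Lemma card_layer : #|P| = #|[pred v | w v == i]|.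
Proof.
rewrite -(fintype.card_image (@enum_val_inj _ V)); apply: eq_card => v.
apply/fintype.imageP/idP => [[r hr ->]|hv]; first by move: hr; rewrite !inE.
by exists (enum_rank v); rewrite ?enum_rankK // !inE enum_rankK.
Qed.

Let EEt : E *m E^T = 1%:M.
Proof.
apply/matrixP => a b; rewrite !mxE (bigD1 (enum_val a)) //= !mxE eqxx mul1r.
rewrite big1 ?addr0 ?(inj_eq enum_val_inj) // => r ne.
by rewrite !mxE (negbTE ne) mul0r.
Qed.

Let mulE q (B : 'M[F]_(#|V|, q)) a k : (E *m B) a k = B (enum_val a) k.
Proof.
rewrite !mxE (bigD1 (enum_val a)) //= !mxE eqxx mul1r big1 ?addr0 // => r ne.
by rewrite mxE (negbTE ne) mul0r.
Qed.

Let mulEtE q (B : 'M[F]_(#|V|, q)) r k :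
  (E^T *m (E *m B)) r k = if P r then B r k else 0.
Proof.
rewrite mxE; case: ifP => hr.
  have rP : r \in P by [].
  rewrite (bigD1 (enum_rank_in rP r)) //= big1 ?addr0.
    by rewrite mulE !mxE enum_rankK_in // eqxx mul1r.
  move=> a ne; rewrite !mxE; case: eqP => [er|_]; rewrite ?mul0r //.
  by case/eqP: ne; apply: enum_val_inj; rewrite enum_rankK_in.
rewrite big1 // => a _; rewrite !mxE; case: eqP => [er|_]; rewrite ?mul0r //.
by have := enum_valP a; rewrite -er inE /=; move: hr => /= ->.
Qed.

Lemma coef_rank_layer_le g :
  (coef_rank i g <= coef_rank i.+1 g + #|[pred v | w v == i]|)%N.
Proof.
rewrite -card_layer /coef_rank.
have -> : coef_mx i g = coef_mx i.+1 g + E^T *m (E *m coef_mx i g).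
  apply/matrixP => r k; rewrite [RHS]mxE mulEtE !mxE /= [(i <= _)%N]leq_eqVlt eq_sym.
  case: eqVneq => [->|_] /=; first by rewrite ltnn add0r.
  by rewrite addr0.
apply: leq_trans (mxrank_add _ _) _; rewrite leq_add2l.
by apply: leq_trans (mxrankM_maxl _ _) _; exact: rank_leq_col.
Qed.

(** If no relation modulo t^g involves an index of weight [i], appending to the
    matrix the coordinates on these indices does not change its left kernel, and
    row operations then make the enlarged matrix block diagonal. *)
Lemma coef_rank_layer_ge g : (g <= T)%N ->
  (forall f, (forall v, (w v < i)%N -> f v = 0) ->
     (forall k, (k < g)%N -> comb phi f k = 0) ->
     forall v, w v = i -> f v = 0) ->
  (coef_rank i.+1 g + #|[pred v | w v == i]| <= coef_rank i g)%N.
Proof.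
move=> le_gT hlayer; rewrite -card_layer /coef_rank.
set B := coef_mx i.+1 g.
have EB0 : E *m B = 0.
  apply/matrixP => a k; rewrite mulE !mxE.
  by have := enum_valP a; rewrite inE => /eqP ->; rewrite ltnn.
have hblock : col_mx (1%:M - E^T *m E) E *m row_mx B E^T = block_mx B 0 0 1%:M.
  rewrite mul_col_row !mulmxBl !mul1mx -!mulmxA EB0 mulmx0 subr0 EEt mulmx1.
  by rewrite subrr.
rewrite -{1}(mxrank1 F #|P|) -rank_diag_block_mx -hblock.
apply: leq_trans (mxrankM_maxr _ _) _.
apply: rank_le_ker => u hu; rewrite mul_mx_row.
have hf := proj1 (ker_coef_mxP i u le_gT) hu.
have hv v : w v = i -> fun_of_row i u v = 0.
  by apply: hlayer => // v'; exact: fun_of_row_low.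
have -> : u *m E^T = 0.
  apply/rowP => a; rewrite -[u *m E^T]trmxK trmx_mul trmxK mxE mulE !mxE.
  have := enum_valP a; rewrite inE => /eqP wa.
  have := hv _ wa; rewrite /fun_of_row wa leqnn enum_valK.
  suff -> : (0 : 'I_1) = ord0 by move=> ->.
  exact: val_inj.
suff -> : u *m B = 0 by rewrite row_mx0.
apply/(ker_coef_mxP _ _ le_gT) => k hk; rewrite -[RHS](hf k hk).
apply: eq_comb => v; rewrite /fun_of_row [(i <= _)%N]leq_eqVlt eq_sym.
case: eqVneq => //= wv; rewrite wv ltnn.
by have := hv _ wv; rewrite /fun_of_row wv leqnn.
Qed.

End Layer.

Let N i g : bool := `[< order_in w phi i g >].

Lemma coef_rank_diff i d : (i + d <= T)%N ->
  coef_rank i (i + d) = (coef_rank i.+1 (i + d) +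
    count (fun k => N i k && ~~ N i.+1 k) (iota i d))%N.
Proof.
elim: d => [|d IHd] hd; first by rewrite addn0 coef_rank0 coef_rankS0.
rewrite -addn1 iotaD count_cat /= addn0 addnA addn1.
have lt_T : (i + d < T)%N by rewrite -addnS.
have hr j : coef_rank j (i + d).+1 = (coef_rank j (i + d) + N j (i + d)%N)%N.
  rewrite /N; case: asboolP => h.
    by rewrite coef_rank_jump ?addn1.
  by rewrite coef_rank_stay ?addn0.
rewrite !hr IHd; last exact: ltnW.
have : N i.+1 (i + d)%N -> N i (i + d)%N.
  by move=> /asboolP h; apply/asboolP; exact: order_in_mono.
move: (count _ (iota i d)) => q.
case: (N i.+1 _) => [-> //|_]; last case: (N i _).
all: by rewrite /= ?addn0 ?addnA // addnAC.
Qed.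

(** The number of new orders below [g] never exceeds the number of indices of
    weight [i], and by hypothesis equals it at every gap [g] that survives; so the
    new orders fill the gaps from [i] on, in increasing order. *)
Lemma order_in_step i k :
  (forall g, (i <= g < T)%N -> ~ order_in w phi i g ->
   forall f, (forall v, (w v < i)%N -> f v = 0) ->
     (forall k, (k < g)%N -> comb phi f k = 0) ->
     forall v, w v = i -> f v = 0) ->
  (k < T)%N ->
  N i k = N i.+1 k || ((i <= k)%N &&
    (count (predC (N i.+1)) (iota i (k - i)) < #|[pred v | w v == i]|)%N).
Proof.
move=> key lt_kT; set q := #|_|.
pose cnt d := count (fun k => N i k && ~~ N i.+1 k) (iota i d).
have cnt_le d : (i + d <= T)%N -> (cnt d <= q)%N.
  move=> hd; have := coef_rank_layer_le i (i + d).
  by rewrite coef_rank_diff // leq_add2l.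
have cnt_eq d : (i + d < T)%N -> ~~ N i (i + d)%N -> cnt d = q.
  move=> hd hN; apply/eqP; rewrite eqn_leq cnt_le ?(ltnW hd) //=.
  rewrite -(leq_add2l (coef_rank i.+1 (i + d))) -coef_rank_diff ?(ltnW hd) //.
  apply: coef_rank_layer_ge; first exact: ltnW.
  by apply: key; [rewrite leq_addr hd|exact/asboolPn].
case hS: (N i.+1 k) => /=.
  by apply/asboolP; apply: order_in_mono; exact/asboolP.
case: (leqP i k) => [le_ik|lt_ki] /=; last first.
  by apply/negP => /asboolP /(order_in_ge phi_low); lia.
have ek : (i + (k - i))%N = k by lia.
case: ltnP => h.
  apply/negPn/negP => hN; have := cnt_eq (k - i)%N; rewrite ek => /(_ lt_kT hN).
  move=> e; move: h; rewrite -e ltnNge; case/negP; apply: sub_count => l /=.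
  by case/andP.
apply/negP => hN.
have cnt_lt : (cnt (k - i) < q)%N.
  have := cnt_le (k - i).+1; rewrite addnS ek => /(_ lt_kT).
  by rewrite /cnt -[(k - i).+1%N]addn1 iotaD count_cat ek /= hN hS /= addn0 addn1.
have : ~~ all (N i) (seq.filter (predC (N i.+1)) (iota i (k - i))).
  apply/negP => hall; move: (leq_trans cnt_lt h); rewrite ltnNge; case/negP.
  rewrite -size_filter -(count_predT (seq.filter _ _)).
  rewrite -(eq_in_count (a1 := N i)); last by move=> l hl /=; rewrite (allP hall).
  by rewrite count_filter.
case/allPn => l; rewrite mem_filter mem_iota ek => /and3P[/= hlS hl1 hl2] hlN.
have hl : (i + (l - i))%N = l by lia.
have := cnt_eq (l - i)%N; rewrite hl => /(_ (ltn_trans hl2 lt_kT) hlN) e.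
move: cnt_lt; rewrite -e ltnNge; case/negP.
have -> : (k - i)%N = ((l - i) + (k - l))%N by lia.
by rewrite /cnt iotaD count_cat leq_addr.
Qed.

End LinearAlgebra.

(** * Monomials on the curve *)

Section LowOrder.
Local Open Scope ring_scope.
Variable A : idomainType.
Implicit Types u q : {poly A}.

Definition vanish_to (k : nat) (q : {poly A}) : Prop :=
  forall l, (l < k)%N -> q`_l = 0.

Lemma vanish_to_mul k q u : vanish_to k q -> vanish_to k (q * u).
Proof.
move=> hq l hl; rewrite coefM big1 // => j _.
by rewrite hq ?mul0r //; have := ltn_ord j; lia.
Qed.

Lemma coef_mul_lead k q u : vanish_to k q -> (q * u)`_k = q`_k * u`_0.
Proof.
move=> hq; rewrite coefM big_ord_recr /= subnn big1 ?add0r // => j _.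
by rewrite hq ?mul0r.
Qed.

Lemma vanish_to_cancel k q u : u`_0 != 0 -> vanish_to k (q * u) -> vanish_to k q.
Proof.
move=> u0; elim: k => [|k IHk] hqu l //.
have hq : vanish_to k q by apply: IHk => l' h; apply: hqu; lia.
rewrite ltnS leq_eqVlt => /orP[/eqP->|/hq//].
have := hqu k (ltnSn k); rewrite coef_mul_lead // => /eqP.
by rewrite mulf_eq0 (negbTE u0) orbF => /eqP.
Qed.

Lemma vanish_to_add k q u : vanish_to k q -> vanish_to k u -> vanish_to k (q + u).
Proof. by move=> hq hu l hl; rewrite coefD hq ?hu ?addr0. Qed.

Lemma vanish_to_opp k q : vanish_to k q -> vanish_to k (- q).
Proof. by move=> hq l hl; rewrite coefN hq ?oppr0. Qed.

Lemma vanish_to_Xn k j q : vanish_to k q -> vanish_to (k + j) ('X^j * q).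
Proof.
move=> hq l hl; rewrite coefXnM; case: ltnP => // h.
by apply: hq; lia.
Qed.

End LowOrder.

(** The curve is normalised by b_k = a_(m+k), so that y = t^m * [ser_y] and
    n p = t^(m-n) * [ser_p]; multiplying p by n keeps orders and avoids
    denominators. The polynomials stop at degree [N], included, so that b_0 occurs
    even when there is no free coefficient. *)
Section Curve.
Local Open Scope ring_scope.
Variables (A : comNzRingType) (n m N : nat) (b : nat -> A).

Definition ser_y : {poly A} := \poly_(k < N.+1) b k.
Definition ser_p : {poly A} := \poly_(k < N.+1) ((m + k)%:R * b k).

Variables (V : finType) (al be ga : V -> nat).

Definition weight (v : V) : nat := (al v * n + be v * m + ga v * (m - n))%N.

Definition mono (v : V) : {poly A} :=
  'X^(weight v) * (ser_y ^+ be v * ser_p ^+ ga v).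

Definition mono_coef (v : V) (k : nat) : A := (mono v)`_k.

Lemma ser_y0 : ser_y`_0 = b 0.
Proof. by rewrite coef_poly. Qed.

Lemma ser_p0 : ser_p`_0 = m%:R * b 0.
Proof. by rewrite coef_poly addn0. Qed.

Lemma mono_low v k : (k < weight v)%N -> mono_coef v k = 0.
Proof. by move=> hk; rewrite /mono_coef coefXnM hk. Qed.

Lemma mono_lead v :
  mono_coef v (weight v) = b 0 ^+ (be v + ga v) * m%:R ^+ ga v.
Proof.
rewrite /mono_coef coefXnM ltnn subnn coef0M -!horner_coef0 !horner_exp.
by rewrite !horner_coef0 ser_y0 ser_p0 exprMn exprD; ring.
Qed.

Lemma comb_mono f k :
  comb mono_coef f k = (\sum_v f v *: mono v)`_k.
Proof. by rewrite coef_sum; apply: eq_bigr => v _; rewrite coefZ. Qed.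

End Curve.

(** * Deforming the curve *)

Section Deformation.
Local Open Scope ring_scope.
Variables (A : idomainType) (n m N : nat) (b : nat -> A) (D : nat -> A -> A).
Hypothesis D_add : forall j x y, D j (x + y) = D j x + D j y.
Hypothesis D_mul : forall j x y, D j (x * y) = D j x * y + x * D j y.
Hypothesis D_b : forall j k, (j < N)%N -> D j (b k) = (j == k)%:R.
Hypothesis b0_neq0 : b 0 != 0.
Hypothesis char0 : forall k, k.+1%:R != 0 :> A.
Hypothesis n_lt_m : (n < m)%N.
Variables (V : finType) (al be ga : V -> nat).

Local Notation y := (ser_y N b).
Local Notation p := (ser_p m N b).
Local Notation wt := (weight n m al be ga).
Local Notation mon := (mono n m N b al be ga).
Local Notation phi := (mono_coef n m N b al be ga).

Lemma D0 j : D j 0 = 0.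
Proof. by apply: (addrI (D j 0)); rewrite -D_add !addr0. Qed.

Lemma D1 j : D j 1 = 0.
Proof. by apply: (addrI (D j 1)); rewrite -{3}[1]mulr1 D_mul mulr1 mul1r addr0. Qed.

Lemma D_nat j k : D j k%:R = 0.
Proof. by elim: k => [|k IHk]; rewrite ?D0 // -natr1 D_add IHk D1 addr0. Qed.

Lemma D_natM j k x : D j (k%:R * x) = k%:R * D j x.
Proof. by rewrite D_mul D_nat mul0r add0r. Qed.

Lemma D_sum j (I : finType) (G : I -> A) : D j (\sum_i G i) = \sum_i D j (G i).
Proof. by apply: (big_morph (D j)); [exact: D_add | exact: D0]. Qed.

Lemma natrI_char0 k l : k%:R = l%:R :> A -> k = l.
Proof.
wlog le_kl : k l / (k <= l)%N.
  by case: (leqP k l) => [h|/ltnW h]; [apply | move=> W e; apply/esym/W].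
move=> e; have : (l - k)%:R = 0 :> A by rewrite natrB // e subrr.
case d: (l - k)%N => [|d']; last by move/eqP; rewrite (negbTE (char0 _)).
by move=> _; lia.
Qed.

Definition dpoly j (q : {poly A}) : {poly A} := \poly_(k < size q) D j q`_k.

Lemma coef_dpoly j q k : (dpoly j q)`_k = D j q`_k.
Proof.
by rewrite coef_poly; case: ltnP => // h; rewrite nth_default // D0.
Qed.

Lemma dpolyD j q r : dpoly j (q + r) = dpoly j q + dpoly j r.
Proof. by apply/polyP => k; rewrite coefD !coef_dpoly coefD D_add. Qed.

Lemma dpolyM j q r : dpoly j (q * r) = dpoly j q * r + q * dpoly j r.
Proof.
apply/polyP => k; rewrite coefD coef_dpoly !coefM D_sum -big_split /=.
by apply: eq_bigr => l _; rewrite D_mul !coef_dpoly.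
Qed.

Lemma dpoly0 j : dpoly j 0 = 0.
Proof. by apply/polyP => k; rewrite coef_dpoly !coef0 D0. Qed.

Lemma dpolyXn j k : dpoly j 'X^k = 0.
Proof. by apply/polyP => l; rewrite coef_dpoly coefXn coef0 D_nat. Qed.

Lemma dpoly1 j : dpoly j 1 = 0.
Proof. by rewrite -(expr0 'X) dpolyXn. Qed.

(* Multiplied by q, to avoid the predecessor of the exponent. *)
Lemma dpoly_exp j q k : dpoly j (q ^+ k) * q = k%:R * q ^+ k * dpoly j q.
Proof.
elim: k => [|k IHk].
  by rewrite expr0 dpoly1 !mul0r.
rewrite exprS dpolyM mulrDl -[q * _ * q]mulrA IHk -natr1; ring.
Qed.

Lemma dpoly_y j : (j < N)%N -> dpoly j y = 'X^j.
Proof.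
move=> hj; apply/polyP => k; rewrite coef_dpoly coefXn coef_poly.
case: ltnP => hk; first by rewrite D_b // eq_sym.
by rewrite D0; case: eqP => // ek; lia.
Qed.

Lemma dpoly_p j : (j < N)%N -> dpoly j p = (m + j)%:R * 'X^j.
Proof.
move=> hj; apply/polyP => k.
rewrite coef_dpoly -polyC_natr coefCM coefXn coef_poly.
case: ltnP => hk.
  by rewrite D_natM D_b // eq_sym; case: eqP => [->|]; rewrite ?mulr0.
by rewrite D0; case: eqP => // ek; rewrite ?mulr0 //; lia.
Qed.

(** Multiplying by the units y and p stripped of their powers of t replaces
    d/dy and d/dp by the operators y d/dy and p d/dp, which only rescale each
    monomial by an exponent. *)
Lemma dpoly_mono j v : (j < N)%N ->
  dpoly j (mon v) * (y * p) =
  'X^j * ((be v)%:R * p + (ga v)%:R * (m + j)%:R * y) * mon v.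
Proof.
move=> hj; rewrite /mono !dpolyM dpolyXn mul0r add0r.
have -> : 'X^(wt v) * (dpoly j (y ^+ be v) * p ^+ ga v +
            y ^+ be v * dpoly j (p ^+ ga v)) * (y * p) =
  'X^(wt v) * ((dpoly j (y ^+ be v) * y) * p ^+ ga v * p +
            y ^+ be v * y * (dpoly j (p ^+ ga v) * p)) by ring.
rewrite !dpoly_exp dpoly_y // dpoly_p //; ring.
Qed.

Definition scale_nat (c : V -> nat) (f : V -> A) : V -> A :=
  fun v => (c v)%:R * f v.

Definition comb_poly (f : V -> A) : {poly A} := \sum_v f v *: mon v.

Lemma variation_comb j f : (j < N)%N ->
  comb_poly (D j \o f) * (y * p) = dpoly j (comb_poly f) * (y * p) -
    'X^j * (comb_poly (scale_nat be f) * p +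
            comb_poly (scale_nat ga f) * ((m + j)%:R * y)).
Proof.
move=> hj; rewrite /comb_poly.
have -> : dpoly j (\sum_v f v *: mon v) =
    \sum_v D j (f v) *: mon v + \sum_v f v *: dpoly j (mon v).
  rewrite (big_morph (dpoly j) (dpolyD j) (dpoly0 j)) -big_split /=.
  apply: eq_bigr => v _; apply/polyP => k.
  by rewrite coefD !coefZ !coef_dpoly coefZ D_mul.
rewrite mulrDl -addrA -[LHS]addr0; congr (_ + _); apply/esym/eqP.
rewrite subr_eq0 mulrDr !mulr_suml !mulr_sumr -big_split /=; apply/eqP.
apply: eq_bigr => v _; rewrite -scalerAl dpoly_mono // /scale_nat.
by rewrite -!mul_polyC !polyCM !polyC_natr; ring.
Qed.

(** The chain rule, read in the lowest degree. Each term other than the series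
    of D_j f comes either from the derivative of the series of [f], which vanishes
    up to degree [g], or from y df/dy and p df/dp, moved up by t^j. *)
Lemma variation_lead f j e g : (j < N)%N -> (e + j <= g)%N ->
  vanish_to g.+1 (comb_poly f) ->
  vanish_to e (comb_poly (scale_nat be f)) ->
  vanish_to e (comb_poly (scale_nat ga f)) ->
  vanish_to (e + j) (comb_poly (D j \o f)) /\
  (comb_poly (D j \o f))`_(e + j) * (m%:R * b 0) =
    - (m%:R * (comb_poly (scale_nat be f))`_e +
       (m + j)%:R * (comb_poly (scale_nat ga f))`_e).
Proof.
move=> hj hg hf hu hv.
have m_neq0 : m%:R != 0 :> A by case: (m) n_lt_m.
have y0 : y`_0 != 0 by rewrite ser_y0.
have p0 : p`_0 != 0 by rewrite ser_p0 mulf_neq0.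
have yp0 : (y * p)`_0 != 0 by rewrite coef0M mulf_neq0.
have hr : vanish_to e (comb_poly (scale_nat be f) * p +
                       comb_poly (scale_nat ga f) * ((m + j)%:R * y)).
  by apply: vanish_to_add; apply: vanish_to_mul.
have hd : vanish_to (e + j).+1 (dpoly j (comb_poly f) * (y * p)).
  apply: vanish_to_mul => l hl; rewrite coef_dpoly hf ?D0 //; lia.
have hS : vanish_to (e + j) (comb_poly (D j \o f)).
  apply: (vanish_to_cancel yp0); rewrite variation_comb //; apply: vanish_to_add.
    by move=> l hl; apply: hd; lia.
  by apply: vanish_to_opp; exact: vanish_to_Xn.
split=> //.
have := coef_mul_lead (y * p) hS; rewrite variation_comb // coefB (hd _ (ltnSn _)).
rewrite coefXnM ltnNge leq_addl /= addnK coefD !coef_mul_lead //.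
have -> : ((m + j)%:R : {poly A})`_0 = (m + j)%:R by rewrite -polyC_natr coefC.
rewrite ser_p0 ser_y0 => h.
apply: (mulfI b0_neq0); move: h; rewrite sub0r => h.
transitivity ((comb_poly (D j \o f))`_(e + j) * (b 0 * (m%:R * b 0))); first by ring.
by rewrite -h; ring.
Qed.

Lemma comb_lincomb (W : finType) (ps : W -> nat -> A) c d f h k :
  comb ps (fun v => c * f v - d * h v) k = c * comb ps f k - d * comb ps h k.
Proof.
rewrite /comb !mulr_sumr -sumrB; apply: eq_bigr => v _; ring.
Qed.

(** The setting of the deformation argument: [g] is a gap of the orders of
    weight at least [i]. *)
Section Layer.
Variables (i g s : nat).
Hypothesis n_gt0 : (0 < n)%N.
Hypothesis le_ig : (i <= g)%N.
Hypothesis g_lt : (g < N + (m - n))%N.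
Hypothesis layer_deg : forall v, wt v = i -> (be v + ga v)%N = s.
Hypothesis layer_inj : forall v v', wt v = i -> wt v' = i -> ga v = ga v' -> v = v'.
Hypothesis not_order : ~ order_in wt phi i g.

Let supp f := forall v, (wt v < i)%N -> f v = 0 :> A.

(* L d f is the value at p/y = m of the d-th iterate of the Euler operator
   p d/dp on the initial form of f. The form vanishes at m to order at least d
   exactly when L 0 f, ..., L (d - 1) f are 0, since m <> 0 and the
   characteristic is 0. *)
Let psi (v : V) (d : nat) : A :=
  if wt v == i then (ga v)%:R ^+ d * m%:R ^+ ga v else 0.
Let L d f := comb psi f d.

Lemma vanish_comb k f : vanish_to k (comb_poly f) <->
  (forall l, (l < k)%N -> comb phi f l = 0).
Proof. by split=> h l hl; have := h l hl; rewrite comb_mono. Qed.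

Lemma supp_scale c f : supp f -> supp (scale_nat c f).
Proof. by move=> hf v hv; rewrite /scale_nat hf ?mulr0. Qed.

Lemma supp_D j f : supp f -> supp (D j \o f).
Proof. by move=> hf v hv; rewrite /= hf ?D0. Qed.

Lemma moment_scale d f : L d (scale_nat ga f) = L d.+1 f.
Proof.
apply: eq_bigr => v _; rewrite /psi /scale_nat.
by case: eqP => _; rewrite ?mulr0 // exprS; ring.
Qed.

(** The point m is constant, so differentiating the coefficients of [f] keeps
    the order to which the initial form vanishes there. *)
Lemma moment_D d j f : L d (D j \o f) = D j (L d f).
Proof.
rewrite /L /comb D_sum; apply: eq_bigr => v _; rewrite D_mul /psi /=.
case: eqP => _; rewrite ?D0 ?mulr0 ?addr0 // -!natrX -natrM D_nat.
by rewrite mulr0 addr0.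
Qed.

Lemma not_order_next f : supp f ->
  vanish_to g (comb_poly f) -> vanish_to g.+1 (comb_poly f).
Proof.
move=> hf hg l; rewrite ltnS leq_eqVlt => /orP[/eqP->|/hg//].
case: (eqVneq (comb_poly f)`_g 0) => // ne0; case: not_order.
exists f; split=> //; first by apply/vanish_comb.
by rewrite comb_mono.
Qed.

Lemma moment0_lead f : supp f -> comb phi f i = b 0 ^+ s * L 0%N f.
Proof.
move=> hf; rewrite /L /comb mulr_sumr; apply: eq_bigr => v _; rewrite /psi.
case: eqP => [wv|/eqP wv].
  have -> : phi v i = b 0 ^+ s * m%:R ^+ ga v.
    by rewrite -(layer_deg wv) -(mono_lead n m N b al be ga) wv.
  by rewrite expr0 mul1r; ring.
case: (ltngtP (wt v) i) => h; last by rewrite h eqxx in wv.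
  by rewrite hf ?mul0r ?mulr0.
by rewrite mono_low // !mulr0.
Qed.

(** Subtracting multiples of [h j] raises the order of [h0] one degree at a
    time without affecting its [d]-th moment, up to a nonzero factor. *)
Lemma eliminate d e h0 (h : nat -> V -> A) :
  supp h0 -> L d h0 != 0 -> vanish_to e (comb_poly h0) -> (e <= g)%N ->
  (forall j, (e + j < g)%N -> [/\ supp (h j), L d (h j) = 0,
     vanish_to (e + j) (comb_poly (h j)) & (comb_poly (h j))`_(e + j) != 0]) ->
  exists f, [/\ supp f, L d f != 0 & vanish_to g (comb_poly f)].
Proof.
move=> s0 L0 v0 le_eg hh.
suff: forall o, (e + o <= g)%N ->
    exists f, [/\ supp f, L d f != 0 & vanish_to (e + o) (comb_poly f)].
  by move/(_ (g - e)%N); rewrite subnKC //; apply.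
elim=> [|o IHo] ho; first by exists h0; split=> //; rewrite addn0.
have lt_o : (e + o < g)%N by rewrite -addnS.
have [f [sf Lf vf]] := IHo (ltnW lt_o).
have [sh Lh vh kh] := hh o lt_o.
pose c := (comb_poly (h o))`_(e + o); pose c' := (comb_poly f)`_(e + o).
exists (fun v => c * f v - c' * h o v); split.
- by move=> v hv; rewrite sf // sh // !mulr0 subrr.
- by rewrite /L comb_lincomb -!/(L _ _) Lh mulr0 subr0 mulf_neq0.
apply/vanish_comb => l; rewrite addnS ltnS leq_eqVlt comb_lincomb => /orP[/eqP->|hl].
  by rewrite !comb_mono mulrC subrr.
by rewrite !comb_mono vf // vh // !mulr0 subrr.
Qed.

Lemma supp_vanish f : supp f -> vanish_to i (comb_poly f).
Proof.
move=> hf l hl; rewrite -comb_mono /comb big1 // => v _.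
case: (ltnP (wt v) i) => h; first by rewrite hf ?mul0r.
by rewrite mono_low ?mulr0 //; lia.
Qed.

(** Induction on the order of vanishing, by the argument given at the top: the
    case [d.+1] for [f] is refuted by the case [d] for p df/dp, corrected by the
    derivatives D_j f. *)
Lemma moment_eq0 d f : supp f -> vanish_to g (comb_poly f) -> L d f = 0.
Proof.
elim: d f => [|d IHd] f sf vf.
  have := not_order_next sf vf (le_ig : (i < g.+1)%N).
  rewrite -comb_mono moment0_lead // => /eqP.
  by rewrite mulf_eq0 expf_eq0 (negbTE b0_neq0) andbF /= => /eqP.
apply/eqP; apply: contraT => Lf.
have m_neq0 : m%:R != 0 :> A by case: (m) n_lt_m.
have le_mi : (m - n <= i)%N.
  have /existsP[v /andP[/eqP wv ga0]] : [exists v, (wt v == i) && (0 < ga v)%N].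
    apply: contraNT Lf => /existsPn hv.
    apply/eqP/big1 => v _; rewrite /psi; case: eqP => [/eqP wv|_]; rewrite ?mulr0 //.
    by have := hv v; rewrite wv /= -eqn0Ngt => /eqP->; rewrite expr0n /= mul0r mulr0.
  by move: wv; rewrite /weight; nia.
pose u := comb_poly (scale_nat be f); pose v := comb_poly (scale_nat ga f).
have Lv : L d (scale_nat ga f) != 0 by rewrite moment_scale.
have sv := supp_scale ga sf; have su := supp_scale be sf.
have ex_e : exists e, (u`_e != 0) || (v`_e != 0).
  apply: contrapT => hno; case/eqP: Lv; apply: IHd => // l _.
  by apply/eqP; apply: contraT => h; case: hno; exists l; rewrite h orbT.
case: (ex_minnP ex_e) => e he e_min.
have ve : vanish_to e v.
  move=> l hl; apply/eqP; apply: contraLR hl => h; rewrite -leqNgt.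
  by apply: e_min; rewrite h orbT.
have ue : vanish_to e u.
  move=> l hl; apply/eqP; apply: contraLR hl => h; rewrite -leqNgt.
  by apply: e_min; rewrite h.
have le_ie : (i <= e)%N.
  rewrite leqNgt; apply/negP => h; move: he.
  by rewrite (supp_vanish su h) (supp_vanish sv h) eqxx.
case: (leqP g e) => [le_ge|lt_eg].
  case/eqP: Lv; apply: IHd => // l hl; apply: ve; lia.
have vf1 := not_order_next sf vf.
have dcoef j : (e + j <= g)%N -> vanish_to (e + j) (comb_poly (D j \o f)) /\
  (comb_poly (D j \o f))`_(e + j) * (m%:R * b 0) = - (m%:R * u`_e + (m + j)%:R * v`_e).
  by move=> h; apply: (variation_lead _ h vf1 ue ve); lia.
(* D_(g-e) f would otherwise give the order g. *)
have relation : m%:R * u`_e + (m + (g - e))%:R * v`_e = 0.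
  have ege : (e + (g - e) = g)%N by lia.
  have [] := dcoef (g - e)%N; rewrite ?ege // => vD kD.
  have sD := supp_D (g - e)%N sf.
  by apply: oppr_inj; rewrite -kD (not_order_next sD vD) ?mul0r ?oppr0.
have ve_neq0 : v`_e != 0.
  apply: contraTneq he => v0; rewrite v0 eqxx orbF negbK.
  by move/eqP: relation; rewrite v0 mulr0 addr0 mulf_eq0 (negbTE m_neq0).
have [f' [sf' Lf' vf']] :
    exists f', [/\ supp f', L d f' != 0 & vanish_to g (comb_poly f')].
  apply: (eliminate (e := e) (h := fun j => D j \o f) sv) => //; first exact: ltnW.
  move=> j hj; have [vD kD] := dcoef j (ltnW hj); split=> //.
  - exact: supp_D.
  - by rewrite moment_D IHd // D0.
  apply/eqP => k0; move: kD; rewrite k0 mul0r => /esym/eqP; rewrite oppr_eq0.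
  have -> : m%:R * u`_e + (m + j)%:R * v`_e = - ((g - e - j)%:R * v`_e).
    have -> : (g - e - j)%:R = (g - e)%:R - j%:R :> A by rewrite natrB //; lia.
    by rewrite -[LHS]subr0 -[X in _ - X]relation !natrD; ring.
  rewrite oppr_eq0 mulf_eq0 (negbTE ve_neq0) orbF.
  case hgej: (g - e - j)%N => [|l]; first by lia.
  by rewrite (negbTE (char0 _)).
by case/eqP: Lf'; apply: IHd.
Qed.

(** All moments vanish, and the exponents of p are pairwise distinct on a
    layer: testing against Lagrange interpolation polynomials isolates each
    coefficient. *)
Lemma layer_vanish f : supp f -> (forall k, (k < g)%N -> comb phi f k = 0) ->
  forall v, wt v = i -> f v = 0.
Proof.
move=> sf /vanish_comb vf v0 wv0.
have Lf d : L d f = 0 by exact: moment_eq0.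
pose pi : {poly A} := \prod_(v | (wt v == i) && (v != v0)) ('X - ((ga v)%:R)%:P).
have piE v : pi.[(ga v)%:R] =
    \prod_(v' | (wt v' == i) && (v' != v0)) ((ga v)%:R - (ga v')%:R).
  rewrite /pi horner_prod; apply: eq_bigr => v' _.
  by rewrite hornerXsubC.
have sum0 : \sum_(v | wt v == i) f v * m%:R ^+ ga v * pi.[(ga v)%:R] = 0.
  transitivity (\sum_(d < size pi) pi`_d * L d f).
    under eq_bigr => v _ do rewrite horner_coef mulr_sumr.
    rewrite exchange_big /=; apply: eq_bigr => d _.
    rewrite /L /comb mulr_sumr big_mkcond; apply: eq_bigr => v _; rewrite /psi.
    by case: ifP => _; [ring | rewrite !mulr0].
  by rewrite big1 // => d _; rewrite Lf mulr0.
have m_neq0 : m%:R != 0 :> A by case: (m) n_lt_m.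
move: sum0; rewrite (bigD1 v0) ?wv0 ?eqxx //= big1 ?addr0 => [|v /andP[wv nv]].
  move/eqP; rewrite !mulf_eq0 expf_eq0 (negbTE m_neq0) andbF orbF piE.
  case/orP=> [/eqP//|/prodf_eq0[v /andP[/eqP wv nv]]].
  by rewrite subr_eq0 => /eqP/natrI_char0/(layer_inj wv0 wv) e; rewrite e eqxx in nv.
by rewrite piE (bigD1 v) ?wv //= subrr mul0r mulr0.
Qed.

End Layer.
End Deformation.

(** * From a domain to its field of fractions *)

Section Denominators.
Local Open Scope ring_scope.
Variable A : idomainType.
Local Notation tofrac := (@FracField.tofrac A).
Local Open Scope quotient_scope.

Lemma fraction_num_den (x : {fraction A}) :
  exists2 d, d != 0 & exists c, tofrac d * x = tofrac c.
Proof.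
elim/quotW: x => r; exists (\d_r)%R; first exact: denom_ratioP.
exists (\n_r)%R; unlock FracField.tofrac; rewrite -[LHS]FracField.pi_mul.
apply/eqmodP; rewrite /= FracField.equivfE /FracField.mulf.
by rewrite !numden_Ratio ?(oner_neq0, mul1r, mulr1, denom_ratioP) // mulrC.
Qed.

Lemma common_denominator (I : finType) (f : I -> {fraction A}) :
  exists2 d, d != 0 & exists f' : I -> A, forall i, tofrac d * f i = tofrac (f' i).
Proof.
have h i : exists dc : A * A, dc.1 != 0 /\ tofrac dc.1 * f i = tofrac dc.2.
  by have [d d0 [c e]] := fraction_num_den (f i); exists (d, c).
have {h}[g hg] := choice h.
exists (\prod_i (g i).1).
  by apply/prodf_neq0 => i _; have [] := hg i.
exists (fun i => (\prod_(j | j != i) (g j).1) * (g i).2) => i.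
rewrite (bigD1 i) //= mulrC !rmorphM /= -(proj2 (hg i)); ring.
Qed.

Lemma common_denominator_mx p q (B : 'M[{fraction A}]_(p, q)) :
  exists2 d, d != 0 & exists X : 'M[A]_(p, q), map_mx tofrac X = tofrac d *: B.
Proof.
have [d d0 [f hf]] := common_denominator (fun ij : 'I_p * 'I_q => B ij.1 ij.2).
exists d => //; exists (\matrix_(i, j) f (i, j)).
by apply/matrixP => i j; rewrite !mxE -hf.
Qed.

Lemma map_tofrac_inj p q : injective (map_mx tofrac : 'M[A]_(p, q) -> 'M_(p, q)).
Proof.
move=> X Y /matrixP h; apply/matrixP => i j; have := h i j; rewrite !mxE.
by move/eqP; rewrite tofrac_eq => /eqP.
Qed.

(** A factorisation of [M] through its rank bounds the rank after evaluation
    from above, and one-sided inverses of the factors bound it from below; both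
    survive wherever the product of their denominators does not vanish. *)
Lemma rank_specialize p q (M : 'M[A]_(p, q)) :
  exists2 d, d != 0 & forall (C : fieldType) (ev : {rmorphism A -> C}),
    ev d != 0 -> \rank (map_mx ev M) = \rank (map_mx tofrac M).
Proof.
pose MF := map_mx tofrac M.
have [d1 d1n [X1 e1]] := common_denominator_mx (col_base MF).
have [d2 d2n [X2 e2]] := common_denominator_mx (row_base MF).
have [d3 d3n [X3 e3]] := common_denominator_mx (pinvmx (col_base MF)).
have [d4 d4n [X4 e4]] := common_denominator_mx (pinvmx (row_base MF)).
have factor : X1 *m X2 = (d1 * d2) *: M.
  apply: map_tofrac_inj; rewrite map_mxM map_mxZ e1 e2 -scalemxAl -scalemxAr.
  by rewrite mulmx_base scalerA rmorphM.
have inverse : X3 *m M *m X4 = (d3 * d4)%:M.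
  apply: map_tofrac_inj; rewrite !map_mxM map_scalar_mx e3 e4.
  rewrite -!scalemxAl -scalemxAr scalerA -/MF rmorphM.
  rewrite -[X in _ *m X *m _](mulmx_base MF).
  rewrite (mulmxA (pinvmx (col_base MF))) mulVpmx ?col_base_full // mul1mx.
  rewrite mulmxVp ?row_base_free //.
  by rewrite scalemx1.
exists (d1 * d2 * (d3 * d4)); first by rewrite !mulf_neq0.
move=> C ev; rewrite rmorphM mulf_eq0 negb_or => /andP[h12 h34].
apply/eqP; rewrite eqn_leq; apply/andP; split.
  rewrite -(mxrank_scale_nz _ h12) -map_mxZ -factor map_mxM.
  by apply: leq_trans (mxrankM_maxl _ _) _; exact: rank_leq_col.
have : \rank (map_mx ev (X3 *m M *m X4)) = \rank MF.
  by rewrite inverse map_scalar_mx -scalemx1 mxrank_scale_nz // mxrank1.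
move=> <-; rewrite !map_mxM.
by apply: leq_trans (mxrankM_maxl _ _) _; exact: mxrankM_maxr.
Qed.

End Denominators.

Section Morphism.
Local Open Scope ring_scope.
Variables (A B : comNzRingType) (h : {rmorphism A -> B}).
Variables (n m N : nat) (b : nat -> A).
Variables (V : finType) (al be ga : V -> nat).

Lemma ser_y_map : map_poly h (ser_y N b) = ser_y N (h \o b).
Proof. by apply/polyP => k; rewrite coef_map /= !coef_poly; case: ifP => _; rewrite ?rmorph0. Qed.

Lemma ser_p_map : map_poly h (ser_p m N b) = ser_p m N (h \o b).
Proof.
apply/polyP => k; rewrite coef_map /= !coef_poly.
by case: ifP => _; rewrite ?rmorph0 // rmorphM rmorph_nat.
Qed.

Lemma mono_coef_map v k :
  h (mono_coef n m N b al be ga v k) = mono_coef n m N (h \o b) al be ga v k.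
Proof.
rewrite /mono_coef -coef_map /mono !rmorphM !rmorphXn /= map_polyX.
by rewrite ser_y_map ser_p_map.
Qed.

End Morphism.

(** * Exponents and valuations below the conductor *)

Section Monoid.
Local Open Scope nat_scope.
Variables (n m : nat).
Hypotheses (n_gt0 : 0 < n) (n_lt_m : n < m) (co_nm : coprime n m).

Lemma coprime_sub : coprime n (m - n).
Proof. by rewrite /coprime -gcdnDr subnK ?(ltnW n_lt_m). Qed.

(** Sylvester: the least multiple s (m - n) in the class of l modulo n has
    s < n, hence it cannot exceed l by n or more. *)
Lemma monoid_above_conductor l : conductor n (m - n) <= l ->
  exists a e, l = a * n + e * (m - n).
Proof.
have co := coprime_sub; rewrite /conductor => hl.
have [u hu] : exists u, (m - n) * u = 1 %[mod n].
  have mn0 : 0 < m - n by rewrite subn_gt0.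
  case: (egcdnP n mn0) => km kn e _; exists km.
  move: co; rewrite coprime_sym /coprime => /eqP co.
  by rewrite mulnC e co modnMDl.
pose s := (l * u) %% n.
have hs : s * (m - n) = l %[mod n].
  rewrite /s modnMml -mulnA -modnMmr [u * _]mulnC hu modnMmr muln1 //.
have lt_sn : s < n by rewrite ltn_mod.
have le_sl : s * (m - n) <= l.
  rewrite leqNgt; apply/negP => h.
  move/eqP: hs; rewrite eqn_mod_dvd; last exact: ltnW.
  by move/dvdn_leq; rewrite subn_gt0 => /(_ h); nia.
move/eqP: hs; rewrite eq_sym eqn_mod_dvd // => /dvdnP[a ha].
by exists a, s; lia.
Qed.

End Monoid.

Section Exponents.
Local Open Scope nat_scope.
Variables (n m : nat).
Hypotheses (n_gt0 : 0 < n) (n_lt_m : n < m).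
Let T := conductor n (m - n).

(** Exponents of the monomials that can have valuation below [T]. *)
Definition expo := ('I_T * 'I_T * 'I_T)%type.
Definition expo_x (v : expo) : nat := v.1.1.
Definition expo_y (v : expo) : nat := v.1.2.
Definition expo_p (v : expo) : nat := v.2.

Let wt := weight n m expo_x expo_y expo_p.

Lemma card_expo_layer i : i < T -> #|[pred v | wt v == i]| = num_monomials n m i.
Proof.
move=> lt_iT; rewrite num_monomialsE.
pose f (v : 'I_i.+1 * 'I_i.+1 * 'I_i.+1) : expo :=
  (widen_ord lt_iT v.1.1, widen_ord lt_iT v.1.2, widen_ord lt_iT v.2).
have f_inj : injective f.
  move=> [[a b] e] [[a' b'] e'] [] h1 h2 h3.
  by congr (_, _, _); apply: val_inj.
rewrite -(fintype.card_image f_inj); apply: eq_card => v.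
apply/idP/fintype.imageP => [|[v' hv' ->]]; last first.
  by move: hv'; rewrite !inE /wt /weight /f /=.
rewrite inE /wt /weight => /eqP wv.
have ha : expo_x v < i.+1 by nia.
have hb : expo_y v < i.+1 by nia.
have he : expo_p v < i.+1 by nia.
exists (Ordinal ha, Ordinal hb, Ordinal he); first by rewrite inE /=; apply/eqP.
move: v wv ha hb he => [[a b] e] wv ha hb he.
by rewrite /f /=; congr (_, _, _); apply: val_inj.
Qed.

Lemma weight_split a b e :
  a * n + b * m + e * (m - n) = (a + b) * n + (b + e) * (m - n).
Proof.
have -> : m = n + (m - n) by rewrite subnKC // ltnW.
by move: (m - n) => k; rewrite addKn !mulnDl mulnDr; lia.
Qed.

Hypothesis co_nm : coprime n m.

(** The valuation is (a + b) n + (b + e) (m - n), so it determines b + e modulo n,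
    and b + e < n below the conductor. *)
Lemma layer_degree (a a' b b' e e' : nat) :
  a * n + b * m + e * (m - n) < T ->
  a * n + b * m + e * (m - n) = a' * n + b' * m + e' * (m - n) ->
  b + e = b' + e'.
Proof.
wlog le_ss : a a' b b' e e' / b + e <= b' + e'.
  move=> W lt_T eq_w; case: (leqP (b + e) (b' + e')) => [h|/ltnW h].
    exact: (W a a').
  by apply/esym; apply: (W a' a _ _ _ _ h); rewrite -eq_w.
rewrite !weight_split /T /conductor => lt_T eq_w.
have lt_n : b' + e' < n.
  rewrite ltnNge; apply/negP => h0; move: lt_T; rewrite eq_w.
  have h : n * (m - n) <= (b' + e') * (m - n) by rewrite leq_mul2r h0 orbT.
  have : (n - 1) * (m - n - 1) <= n * (m - n) by apply: leq_mul; exact: leq_subr.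
  by move: h; lia.
have : (a' + b') * n + (b' + e' - (b + e)) * (m - n) = (a + b) * n.
  rewrite -(subnKC le_ss) mulnDl in eq_w; lia.
move=> h; have : n %| (b' + e' - (b + e)) * (m - n).
  by rewrite -(dvdn_addr _ (dvdn_mull (a' + b') (dvdnn n))) h dvdn_mull.
rewrite Gauss_dvdl ?coprime_sub // => /dvdn_leq; case: posnP; first lia.
by move=> h1 /(_ isT); lia.
Qed.

Lemma expo_layer_deg v v' : wt v < T -> wt v = wt v' ->
  expo_y v + expo_p v = expo_y v' + expo_p v'.
Proof. exact: layer_degree. Qed.

Lemma expo_layer_inj v v' : wt v < T -> wt v = wt v' ->
  expo_p v = expo_p v' -> v = v'.
Proof.
move=> lt_T eq_w eq_p; have eq_yp := expo_layer_deg lt_T eq_w.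
have eq_y : expo_y v = expo_y v' by lia.
have eq_x : expo_x v = expo_x v'.
  move: eq_w; rewrite /wt /weight eq_y eq_p; nia.
move: v v' eq_x eq_y eq_p {lt_T eq_w eq_yp} => [[a b] e] [[a' b'] e'].
by rewrite /expo_x /expo_y /expo_p /= => /val_inj-> /val_inj-> /val_inj->.
Qed.

Lemma num_monomials_mult i : i < T -> n %| i -> num_monomials n m i = 1.
Proof.
move=> lt_iT /dvdnP[a def_i].
rewrite num_monomialsE; have ha : a < i.+1 by nia.
apply: (@fintype.eq_card1 _ (Ordinal ha, ord0, ord0)) => v; rewrite !inE.
apply/eqP/eqP => [wv|->] /=; last by rewrite /= def_i; lia.
have eqs : v.1.2 + v.2 = 0 + 0.
  apply: (@layer_degree v.1.1 a); rewrite wv // def_i; lia.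
case: v wv eqs => [[x y] p] /= wv eqs.
congr (_, _, _); apply: val_inj => /=; nia.
Qed.

End Exponents.

Lemma truncation_lt n m g : (1 < n)%N -> (n < m)%N -> (g < conductor n (m - n))%N ->
  (g < conductor n m - m + (m - n))%N.
Proof. by rewrite /conductor; nia. Qed.

(** * The orders for generic coefficients *)

Section Generic.
Local Open Scope ring_scope.
Variables (A : idomainType) (n m N : nat) (b : nat -> A) (D : nat -> A -> A).
Hypothesis D_add : forall j x y, D j (x + y) = D j x + D j y.
Hypothesis D_mul : forall j x y, D j (x * y) = D j x * y + x * D j y.
Hypothesis D_b : forall j k, (j < N)%N -> D j (b k) = (j == k)%:R.
Hypothesis b0_neq0 : b 0 != 0.
Hypothesis char0 : forall k, k.+1%:R != 0 :> A.
Hypotheses (n_gt1 : (1 < n)%N) (n_lt_m : (n < m)%N) (co_nm : coprime n m).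
Hypothesis N_def : N = (conductor n m - m)%N.

Let T := conductor n (m - n).
Local Notation tofrac := (@FracField.tofrac A).
Local Notation wt := (weight n m (@expo_x n m) (@expo_y n m) (@expo_p n m)).
Local Notation phi := (mono_coef n m N b (@expo_x n m) (@expo_y n m) (@expo_p n m)).
Local Notation phiF :=
  (mono_coef n m N (tofrac \o b) (@expo_x n m) (@expo_y n m) (@expo_p n m)).

Lemma comb_tofrac f k : comb phiF (tofrac \o f) k = tofrac (comb phi f k).
Proof.
rewrite rmorph_sum; apply: eq_bigr => v _; rewrite rmorphM /=.
by rewrite mono_coef_map.
Qed.

(** [layer_vanish] speaks of coefficients in the domain, which carries the
    derivations; linear algebra needs it over the field of fractions. *)
Lemma generic_layer i g : (i <= g < T)%N -> ~ order_in wt phiF i g ->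
  forall f, (forall v, (wt v < i)%N -> f v = 0) ->
    (forall k, (k < g)%N -> comb phiF f k = 0) -> forall v, wt v = i -> f v = 0.
Proof.
move=> /andP[le_ig lt_gT] hN f sf vf v0 wv0.
have n_gt0 := ltnW n_gt1.
have [d d0 [f' hf']] := common_denominator f.
have dF0 : tofrac d != 0 by rewrite tofrac_eq0.
have f'0 v : f v = 0 -> f' v = 0.
  by move=> fv; apply/eqP; rewrite -tofrac_eq0 -hf' fv mulr0.
have lt_iT : (i < T)%N by exact: leq_ltn_trans lt_gT.
suff : f' v0 = 0.
  move=> e; have := hf' v0; rewrite e rmorph0 => /eqP.
  by rewrite mulf_eq0 (negbTE dF0) => /eqP.
apply: (layer_vanish D_add D_mul D_b b0_neq0 char0 n_lt_m n_gt0 le_ig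
         _ (s := (expo_y v0 + expo_p v0)%N)) (wv0).
- by rewrite N_def truncation_lt.
- move=> v wv; apply: expo_layer_deg => //; last exact: etrans (esym wv0).
  exact: leq_ltn_trans (eq_leq wv) lt_iT.
- move=> v v' wv wv'; apply: expo_layer_inj => //; last exact: etrans (esym wv').
  exact: leq_ltn_trans (eq_leq wv) lt_iT.
- move=> [h [h1 h2 h3]]; apply: hN; exists (tofrac \o h); split.
  + by move=> v hv; rewrite /= h1 ?rmorph0.
  + by move=> k hk; rewrite comb_tofrac h2 ?rmorph0.
  + by rewrite comb_tofrac tofrac_eq0.
- by move=> v hv; apply: f'0; apply: sf.
move=> k hk; apply/eqP; rewrite -tofrac_eq0 -comb_tofrac; apply/eqP.
transitivity (tofrac d * comb phiF f k); last by rewrite vf ?mulr0.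
by rewrite /comb mulr_sumr; apply: eq_bigr => v _; rewrite mulrA hf'.
Qed.

(** From [T] on every integer has a monomial of that valuation and no gap is left
    when its turn comes; below [T] the rule is [order_in_step]. *)
Lemma Gamma_generic k :
  Gamma n m k = (T <= k)%N || `[< order_in wt phiF 0 k >].
Proof.
have n_gt0 := ltnW n_gt1.
have low v l : (l < wt v)%N -> phiF v l = 0 by exact: mono_low.
pose Nh i l := (i <= l)%N && ((T <= l)%N || `[< order_in wt phiF i l >]).
have le_Tc : (T <= conductor n m)%N by rewrite /T /conductor; nia.
have NhE i l : (l < T)%N -> Nh i l = `[< order_in wt phiF i l >].
  move=> lt_lT; rewrite /Nh (leqNgt T) lt_lT /=; case: asboolP; rewrite ?andbF //.
  by move=> h; rewrite (order_in_ge low h).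
have Nh_step i l : (i < conductor n m)%N -> Nh i l = Nh i.+1 l ||
    (i <= l)%N && (count (predC (Nh i.+1)) (iota i (l - i)) < num_monomials n m i)%N.
  move=> lt_ic; case: (leqP T i) => [le_Ti|lt_iT].
    rewrite /Nh; case: (ltngtP i l) => //= [lt_il|eq_il].
      by rewrite (leq_trans le_Ti (ltnW lt_il)).
    rewrite -eq_il le_Ti subnn /= num_monomials_gt0 //.
    apply/esym/in_monoid2P => //; apply: monoid_above_conductor => //.
  case: (leqP T l) => [le_Tl|lt_lT].
    by rewrite /Nh le_Tl (ltnW (leq_trans lt_iT le_Tl)) (leq_trans lt_iT le_Tl).
  rewrite !NhE // (order_in_step low (T := T)) //; last first.
    by move=> g; exact: generic_layer.
  congr (_ || (_ && (_ < _)%N)); last exact: card_expo_layer.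
  apply: eq_in_count => j; rewrite mem_iota => hj /=; rewrite NhE //; lia.
rewrite (Gamma_by_layers (N := Nh) erefl) //.
- by move=> l; rewrite /Nh; case: leqP => //= h; rewrite (leq_trans le_Tc h).
move=> i l lt_ic ni; case: (leqP T i) => [le_Ti|lt_iT].
  rewrite /Nh; case: (ltngtP i l) => //= [lt_il|eq_il].
    by rewrite (leq_trans le_Ti (ltnW lt_il)) ?orbT.
  by rewrite -eq_il le_Ti.
rewrite Nh_step // num_monomials_mult // orbC; case: eqP => [->|/eqP ne].
  by rewrite leqnn subnn.
case hS: (Nh i.+1 l); rewrite ?orbT //= orbF.
apply/negP => /andP[le_il].
have -> : (l - i = (l - i).-1.+1)%N by lia.
by rewrite /= {1}/Nh ltnn.
Qed.

End Generic.

(** * Convergent power series *)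

Section Truncation.
Local Open Scope ring_scope.
Variable K : fieldType.
Implicit Types (f g : nat -> K) (q r : {poly K}).

Definition agree (T : nat) (f : nat -> K) (q : {poly K}) : Prop :=
  forall k, (k < T)%N -> f k = q`_k.

Lemma agree_psmul T f g q r : agree T f q -> agree T g r -> agree T (psmul f g) (q * r).
Proof.
move=> hf hg k hk; rewrite /psmul coefM; apply: eq_bigr => i _.
by rewrite hf ?hg //; have := ltn_ord i; lia.
Qed.

Lemma agree_psexp T f q d : agree T f q -> agree T (psexp f d) (q ^+ d).
Proof.
move=> hf; elim: d => [|d IHd]; first by move=> k _; rewrite expr0 coef1.
by rewrite exprS; exact: agree_psmul.
Qed.

Variables (n m : nat) (a : nat -> K).
Hypotheses (n_gt0 : (0 < n)%N) (n_lt_m : (n < m)%N).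

Definition ps_mono (i j e : nat) : nat -> K :=
  psmul (psmul (psexp (curve_x K n) i) (psexp (curve_y m a) j))
        (psexp (curve_p n m a) e).

(** The coefficients below [T] of y and p involve [b k] for [k < N] only,
    whence the bound on [T]. *)
Lemma ps_mono_coef T N b (V : finType) (al be ga : V -> nat) v k :
  (forall l, (l < N)%N -> b l = a (m + l)%N) -> (T <= N + (m - n))%N ->
  (k < T)%N ->
  ps_mono (al v) (be v) (ga v) k =
    n%:R^-1 ^+ ga v * mono_coef n m N b al be ga v k.
Proof.
move=> hb hT hk.
have hx : agree T (curve_x K n) 'X^n by move=> l hl; rewrite coefXn.
have hy : agree T (curve_y m a) ('X^m * ser_y N b).
  move=> l hl; rewrite /curve_y coefXnM ltnNge; case: leqP => //= h.
  by rewrite coef_poly ifT ?hb ?subnKC //; lia.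
have hp : agree T (curve_p n m a) ((n%:R^-1)%:P * ('X^(m - n) * ser_p m N b)).
  move=> l hl; rewrite /curve_p coefCM coefXnM.
  rewrite (_ : (l < m - n)%N = ~~ (m <= l + n)%N); last by lia.
  case: leqP => /= h; last by rewrite mulr0.
  rewrite coef_poly ifT; last lia.
  rewrite hb; last lia.
  by rewrite (_ : (m + (l - (m - n)))%N = (l + n)%N) ?mulrA 1?[_ * n%:R^-1]mulrC //; lia.
have := agree_psmul (agree_psmul (agree_psexp (al v) hx) (agree_psexp (be v) hy))
  (agree_psexp (ga v) hp) hk.
rewrite /ps_mono => ->; rewrite /mono_coef -coefCM.
apply: (congr1 (fun q : {poly K} => q`_k)).
rewrite !exprMn -!exprM /mono /weight [(al v * n)%N]mulnC [(be v * m)%N]mulnC.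
by rewrite [(ga v * _)%N]mulnC !exprD rmorphXn /=; ring.
Qed.

Lemma ps_mono_low i j e k : (k < i * n + j * m + e * (m - n))%N ->
  ps_mono i j e k = 0.
Proof.
move=> hk.
rewrite (ps_mono_coef (V := unit) (T := k.+1) (N := k.+1) (fun _ => i) (fun _ => j)
  (fun _ => e) tt (b := fun l => a (m + l)%N)) //; last lia.
by rewrite mono_low ?mulr0.
Qed.

Lemma ps_mono_lead i j e : n%:R != 0 :> K -> m%:R != 0 :> K -> a m != 0 ->
  ps_mono i j e (i * n + j * m + e * (m - n))%N != 0.
Proof.
move=> n0 m0 am0; set k := (_ + _)%N.
rewrite (ps_mono_coef (V := unit) (T := k.+1) (N := k.+1) (fun _ => i) (fun _ => j)
  (fun _ => e) tt (b := fun l => a (m + l)%N)) //; last lia.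
rewrite mulf_neq0 ?expf_neq0 ?invr_neq0 //.
rewrite -[k]/(weight n m (fun _ => i) (fun _ => j) (fun _ => e) tt) mono_lead.
by rewrite mulf_neq0 ?expf_neq0 // addn0.
Qed.

Lemma sum_truncate B k (F : nat -> K) : (k < B)%N ->
  (forall i, (k < i)%N -> F i = 0) -> \sum_(i < k.+1) F i = \sum_(i < B) F i.
Proof.
move=> hk hF; rewrite (big_ord_widen B F hk) big_mkcond.
by apply: eq_bigr => i _; case: ltnP => // h; rewrite hF.
Qed.

Lemma pssubst_wide (f : nat -> nat -> nat -> K) B k : (k < B)%N ->
  pssubst f (curve_x K n) (curve_y m a) (curve_p n m a) k =
  \sum_(i < B) \sum_(j < B) \sum_(e < B) f i j e * ps_mono i j e k.
Proof.
move=> hk; rewrite /pssubst -/ps_mono.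
have low i j e : (k < i + j + e)%N -> f i j e * ps_mono i j e k = 0.
  by move=> h; rewrite ps_mono_low ?mulr0 //; nia.
transitivity (\sum_(i < k.+1) \sum_(j < B) \sum_(e < B) f i j e * ps_mono i j e k).
  apply: eq_bigr => i _.
  transitivity (\sum_(j < k.+1) \sum_(e < B) f i j e * ps_mono i j e k).
    apply: eq_bigr => j _.
    apply: (sum_truncate (F := fun e => f i j e * ps_mono i j e k) hk) => e he.
    by apply: low; lia.
  apply: (sum_truncate (F := fun j => \sum_(e < B) f i j e * ps_mono i j e k) hk).
  by move=> j hj; apply: big1 => e _; apply: low; lia.
apply: (sum_truncate (F := fun i => \sum_(j < B) \sum_(e < B) f i j e * ps_mono i j e k) hk).
by move=> i hi; apply: big1 => j _; apply: big1 => e _; apply: low; lia.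
Qed.

End Truncation.

Section Semigroup.
Local Open Scope ring_scope.
Variables (R : realType) (n m : nat) (a : nat -> R[i]).
Hypotheses (n_gt0 : (0 < n)%N) (n_lt_m : (n < m)%N).
Let T := conductor n (m - n).

Lemma convergent3_finite B (f : nat -> nat -> nat -> R[i]) :
  (forall i j e, ~~ [&& i < B, j < B & e < B]%N -> f i j e = 0) -> convergent3 f.
Proof.
move=> hf; exists 1 => //; rewrite /summable.
set F := fun v => _.
pose S : set (nat * nat * nat) := range
  (fun v : 'I_B * 'I_B * 'I_B => (v.1.1 : nat, v.1.2 : nat, v.2 : nat)).
have finS : finite_set S by apply: finite_image; exact: finite_finset.
rewrite (esumID S) ?setTI; last by move=> v _; exact: abse_ge0.
rewrite (esum1 (D := ~` S)) ?adde0; last first.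
  move=> [[i j] e] hS; rewrite /F /= hf ?ComplexField.Normc.normc0 ?mul0r ?normr0 //.
  apply/negP => /and3P[hi hj he]; apply: hS.
  by exists (Ordinal hi, Ordinal hj, Ordinal he).
rewrite esum_fset //.
rewrite fsbig_finite //=; apply/lte_sum_pinfty => v _; exact: ltry.
Qed.

Let N0 := (conductor n m - m)%N.

(** Below [T] a series acts through its finitely many coefficients of small
    exponents, and conversely these define a polynomial. *)
Lemma semigroup_below (b : nat -> R[i]) l :
  (1 < n)%N -> (forall k, (k < N0)%N -> b k = a (m + k)%N) -> (l < T)%N ->
  legendrian_semigroup n m a l <->
  order_in (weight n m (@expo_x n m) (@expo_y n m) (@expo_p n m))
    (mono_coef n m N0 b (@expo_x n m) (@expo_y n m) (@expo_p n m)) 0 l.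
Proof.
move=> n_gt1 hb lt_lT.
have n0 : n%:R != 0 :> R[i] by rewrite pnatr_eq0 -lt0n.
have hTN : (T <= N0 + (m - n))%N by rewrite /T /N0 /conductor; nia.
have substE f k : (k < T)%N ->
    pssubst f (curve_x _ n) (curve_y m a) (curve_p n m a) k =
    comb (mono_coef n m N0 b (@expo_x n m) (@expo_y n m) (@expo_p n m))
      (fun v => f (expo_x v) (expo_y v) (expo_p v) * n%:R^-1 ^+ expo_p v) k.
  move=> hk; rewrite (pssubst_wide _ n_gt0 n_lt_m _ hk) pair_bigA pair_bigA /=.
  apply: eq_bigr => v _; rewrite -mulrA; congr (_ * _).
  exact: (ps_mono_coef n_gt0 n_lt_m (@expo_x n m) (@expo_y n m) (@expo_p n m) v hb hTN hk).
split=> [[f _ [fl fk]]|[f [_ fk fl]]].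
  exists (fun v => f (expo_x v) (expo_y v) (expo_p v) * n%:R^-1 ^+ expo_p v).
  split=> // [k hk|]; rewrite -substE //; last exact: ltn_trans lt_lT.
  exact: fk.
pose g i j e : R[i] := if (insub i, insub j, insub e) is
    (Some i', Some j', Some e') then f (i', j', e') * n%:R ^+ e else 0.
have gE v : g (expo_x v) (expo_y v) (expo_p v) * n%:R^-1 ^+ expo_p v = f v.
  rewrite /g !valK; case: v => [[x y] p] /=.
  by rewrite -mulrA -exprMn divff // expr1n mulr1.
have gS k : (k < T)%N -> pssubst g (curve_x _ n) (curve_y m a) (curve_p n m a) k =
    comb (mono_coef n m N0 b (@expo_x n m) (@expo_y n m) (@expo_p n m)) f k.
  by move=> hk; rewrite substE //; apply: eq_bigr => v _; rewrite gE.
exists g.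
  apply: (@convergent3_finite T) => i j e; rewrite /g.
  by do 3?[case: insubP => [? -> _|_]] => //; rewrite ?andbF.
by split=> [|k hk]; [rewrite gS | rewrite gS ?fk // (ltn_trans hk)].
Qed.

Hypotheses (co_nm : coprime n m) (am_neq0 : a m != 0).

Lemma semigroup_above l : (T <= l)%N -> legendrian_semigroup n m a l.
Proof.
move=> /(monoid_above_conductor n_gt0 n_lt_m co_nm)[x [e def_l]].
exists (fun i j k => ((i == x) && (j == 0%N) && (k == e))%:R).
  apply: (@convergent3_finite (x + e).+1) => i j k h.
  by case: eqP => //= ex; case: eqP => //= ej; case: eqP => //= ek; lia.
have substE k : (k <= l)%N ->
  pssubst (fun i j k => ((i == x) && (j == 0%N) && (k == e))%:R)
    (curve_x R[i] n) (curve_y m a) (curve_p n m a) k = ps_mono n m a x 0 e k.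
  move=> hk; rewrite (@pssubst_wide _ _ _ _ _ _ _ (l + x + e).+1) //; last lia.
  have hx : (x < (l + x + e).+1)%N by lia.
  have he : (e < (l + x + e).+1)%N by lia.
  rewrite (bigD1 (Ordinal hx)) //= [X in _ + X]big1 ?addr0 => [|i ne]; last first.
    apply: big1 => j _; apply: big1 => k' _.
    by rewrite (_ : (i == x :> nat) = false) ?mul0r //; apply/negbTE.
  rewrite (bigD1 ord0) //= [X in _ + X]big1 ?addr0 => [|j ne]; last first.
    apply: big1 => k' _; rewrite (_ : (j == 0%N :> nat) = false) ?andbF ?mul0r //.
    exact/negbTE.
  rewrite (bigD1 (Ordinal he)) //= [X in _ + X]big1 ?addr0 => [|k' ne]; last first.
    by rewrite (_ : (k' == e :> nat) = false) ?andbF ?mul0r //; apply/negbTE.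
  by rewrite !eqxx mul1r.
have lw : l = (x * n + 0 * m + e * (m - n))%N by lia.
split=> [|k hk]; last by rewrite substE ?ps_mono_low // ?(ltnW hk) // -lw.
by rewrite substE // lw ps_mono_lead // pnatr_eq0; lia.
Qed.

End Semigroup.

(** * Specialisation of the coefficients *)

Section Specialization.
Local Open Scope ring_scope.
Variables (A : idomainType) (V : finType) (w : V -> nat) (phi : V -> nat -> A).
Variable T : nat.
Local Notation tofrac := (@FracField.tofrac A).

Lemma order_in_rank (F : fieldType) (ph : V -> nat -> F) g : (g < T)%N ->
  order_in w ph 0 g <-> coef_rank w ph T 0 g.+1 = (coef_rank w ph T 0 g).+1.
Proof.
move=> lt_gT; split; first exact: coef_rank_jump.
move=> h; apply: contrapT => /(coef_rank_stay lt_gT) h'.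
by move: h; rewrite h' => /eqP; rewrite ltn_eqF.
Qed.

(** The orders below [T] are read off from finitely many ranks. *)
Lemma order_in_specialize : exists2 d : A, d != 0 &
  forall (C : fieldType) (ev : {rmorphism A -> C}), ev d != 0 ->
  forall g, (g < T)%N ->
    order_in w (fun v k => ev (phi v k)) 0 g <->
    order_in w (fun v k => tofrac (phi v k)) 0 g.
Proof.
pose M g : 'M[A]_(#|V|, T) := \matrix_(r, k)
  if (0 <= w (enum_val r))%N && (k < g)%N then phi (enum_val r) k else 0.
have h (g : 'I_T.+1) : exists d : A, d != 0 /\
    forall (C : fieldType) (ev : {rmorphism A -> C}),
    ev d != 0 -> \rank (map_mx ev (M g)) = \rank (map_mx tofrac (M g)).
  by have [d d0 hd] := rank_specialize (M g); exists d.
have {h}[d hd] := choice h.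
have mapM (C : nzRingType) (ev : {rmorphism A -> C}) (g : nat) : map_mx ev (M g) =
    \matrix_(r, k) if (0 <= w (enum_val r))%N && (k < g)%N
                   then ev (phi (enum_val r) k) else 0.
  by apply/matrixP => r k; rewrite !mxE; case: ifP => _; rewrite ?rmorph0.
exists (\prod_g d g); first by apply/prodf_neq0 => g _; have [] := hd g.
move=> C ev; rewrite rmorph_prod => /prodf_neq0 hev g lt_gT.
have rankE (g' : 'I_T.+1) : coef_rank w (fun v k => ev (phi v k)) T 0 g' =
    coef_rank w (fun v k => tofrac (phi v k)) T 0 g'.
  by have := (hd g').2 _ ev (hev g' isT); rewrite !mapM.
rewrite !order_in_rank // (rankE (Ordinal (lt_gT : (g.+1 < T.+1)%N))).
by rewrite (rankE (Ordinal (ltnW lt_gT : (g < T.+1)%N))).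
Qed.

End Specialization.

Section Nonvanishing.
Local Open Scope ring_scope.

Lemma base_expansion_inj (N B : nat) (f g : nat -> nat) :
  (forall i, (f i < B)%N) -> (forall i, (g i < B)%N) ->
  (\sum_(i < N) f i * B ^ i = \sum_(i < N) g i * B ^ i)%N ->
  forall i, (i < N)%N -> f i = g i.
Proof.
elim: N f g => [|N IHN] f g hf hg e i hi; first by [].
have B_gt0 : (0 < B)%N by apply: leq_ltn_trans (hf 0%N).
have shift (h : nat -> nat) : (\sum_(i < N.+1) h i * B ^ i =
    h 0 + (\sum_(i < N) h i.+1 * B ^ i) * B)%N.
  rewrite big_ord_recl expn0 muln1 big_distrl /=; congr (_ + _)%N.
  by apply: eq_bigr => j _; rewrite /bump /= add1n expnS mulnCA mulnC.
move: e; rewrite !shift => e.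
have e0 : f 0%N = g 0%N.
  have := congr1 (modn^~ B) e.
  by rewrite /= ![(_ 0 + _)%N]addnC !modnMDl !modn_small.
case: i hi => // i hi; apply: (IHN (f \o succn) (g \o succn)) => //=.
by move/eqP: e; rewrite e0 eqn_add2l eqn_pmul2r // => /eqP.
Qed.

Variables (C : numFieldType) (N : nat).

Lemma poly_nonroot (q : {poly C}) : q != 0 -> exists z, q.[z] != 0.
Proof.
move=> q0; apply: contrapT => h.
have := max_poly_roots q0 (rs := [seq k%:R | k <- iota 0 (size q)]).
rewrite size_map size_iota ltnn => absurd; suff: false by []; apply: absurd.
  apply/allP => z _; rewrite /root; apply: contraT => hz; case: h.
  by exists z.
by rewrite map_inj_uniq ?iota_uniq // => k l /eqP; rewrite eqr_nat => /eqP.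
Qed.

(** Kronecker substitution: putting X_i = z^(B^i), with B larger than all
    degrees, keeps monomials apart and reduces to one variable. *)
Lemma mpoly_nonzero_value (q : mpoly N C) : q != 0 -> exists u, meval u q != 0.
Proof.
move=> q0; pose B := (mmeasure mdeg q).+1.
pose e (mu : multinom N) : nat := (\sum_(i < N) mu i * B ^ i)%N.
have e_inj : {in msupp q &, injective e}.
  move=> m1 m2 h1 h2; rewrite /e => h; apply/mnmP => i.
  pose ext (mu : multinom N) (j : nat) := if insub j is Some j' then mu j' else 0%N.
  have extE mu (j : 'I_N) : ext mu j = mu j by rewrite /ext valK.
  have ext_lt mu j : mu \in msupp q -> (ext mu j < B)%N.
    move=> hmu; rewrite /ext; case: insubP => // j' _ _.
    rewrite ltnS; apply: leq_trans (ltnW (msize_mdeg_lt hmu)).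
    by rewrite mdegE (bigD1 j') //= leq_addr.
  rewrite -!extE; apply: (@base_expansion_inj N B) => //; try by move=> j; apply: ext_lt.
  by under eq_bigr do rewrite extE; rewrite h; apply: eq_bigr => j _; rewrite extE.
pose Q : {poly C} := \sum_(mu <- msupp q) mcoeff mu q *: 'X^(e mu).
have Q0 : Q != 0.
  have hl := mlead_supp q0.
  apply: contraTneq hl => Q0; rewrite mcoeff_msupp negbK.
  have hl := mlead_supp q0.
  have := congr1 (fun r : {poly C} => r`_(e (mlead q))) Q0; rewrite coef0 => <-.
  rewrite /Q coef_sum (bigD1_seq (mlead q)) ?msupp_uniq //= big_seq_cond big1.
    by rewrite coefZ coefXn eqxx mulr1 addr0.
  move=> mu /andP[hmu ne]; rewrite coefZ coefXn; case: eqP => [/e_inj em|]; last by rewrite mulr0.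
  by rewrite em ?eqxx in ne.
have [z hz] := poly_nonroot Q0.
exists (fun i => z ^+ (B ^ i)); apply: contraNneq hz => hq.
apply/eqP; rewrite -hq mevalE horner_sum; apply: eq_bigr => mu _.
rewrite hornerZ hornerXn /e -prodrXr; congr (_ * _); apply: eq_bigr => i _.
by rewrite -exprM mulnC.
Qed.

End Nonvanishing.

Section GenericParameters.
Local Open Scope ring_scope.
Variables (C : numFieldType) (N : nat).

(** The generic coefficients: variables as long as there are some, and then 1, so
    that the leading coefficient is nonzero in all cases. *)
Definition var (k : nat) : mpoly N C :=
  if insub k is Some i then mpolyX C (mnm1 i) else 1.

Definition dvar (j : nat) (q : mpoly N C) : mpoly N C :=
  if insub j is Some i then mderiv i q else 0.

Lemma dvarD j q r : dvar j (q + r) = dvar j q + dvar j r.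
Proof. by rewrite /dvar; case: insubP => [i _ _|_]; rewrite ?mderivD ?addr0. Qed.

Lemma dvarM j q r : dvar j (q * r) = dvar j q * r + q * dvar j r.
Proof.
rewrite /dvar; case: insubP => [i _ _|_]; rewrite ?mderivM //.
by rewrite mul0r mulr0 addr0.
Qed.

Lemma dvar_var j k : (j < N)%N -> dvar j (var k) = (j == k)%:R.
Proof.
move=> hj; rewrite /dvar insubT /var; case: insubP => [i _ <-|hk].
  rewrite mderivX mnm1E; case: (eqVneq i (Ordinal hj)) => [->|ne].
    rewrite eqxx scale1r (_ : mnm_sub _ _ = mnm0) ?mpolyX0 //.
    by apply/mnmP => l; rewrite mnmBE subnn mnm0E.
  rewrite scale0r (_ : (j == i) = false) //; apply: contraNF ne => /eqP e.
  by apply/eqP/val_inj.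
rewrite -mpolyC1 mderivC (_ : (j == k) = false) //.
by apply: contraNF hk => /eqP <-.
Qed.

Lemma var0_neq0 : var 0 != 0.
Proof.
rewrite /var; case: insubP => [i _ _|_]; last exact: oner_neq0.
apply/eqP => h; have := mevalXU (fun=> 1 : C) i.
by rewrite h meval0 => /eqP; rewrite eq_sym oner_eq0.
Qed.

Lemma mpoly_char0 k : k.+1%:R != 0 :> mpoly N C.
Proof.
apply/eqP => h; have := congr1 (meval (fun=> 0 : C)) h.
by rewrite rmorph_nat meval0 => /eqP; rewrite pnatr_eq0.
Qed.

Lemma meval_var u (i : 'I_N) : meval u (var i) = u i.
Proof. by rewrite /var valK mevalXU. Qed.

End GenericParameters.

Section Zariski.
Local Open Scope ring_scope.
Local Open Scope classical_set_scope.
Variables (C : numFieldType) (N : nat) (q : mpoly N C).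

Lemma principal_open : zariski_open [set u | meval u q != 0].
Proof.
exists [set q]; apply/seteqP; split=> u /=.
  by move=> /negP; rewrite negbK => /eqP h _ ->.
by move=> h; rewrite (h q erefl) eqxx.
Qed.

Lemma principal_dense : q != 0 -> zariski_dense [set u | meval u q != 0].
Proof.
move=> q0 V [S VS] [u0 Vu0].
have [r Sr ru0] : exists2 r, S r & meval u0 r != 0.
  apply: contrapT => h; have : (~` V) u0; last by apply.
  rewrite VS => r Sr; apply/eqP; apply: contraT => hr; case: h.
  by exists r.
have r0 : r != 0 by apply: contraNneq ru0 => ->; rewrite meval0.
have [u hu] := mpoly_nonzero_value (mulf_neq0 q0 r0).
move: hu; rewrite mevalM mulf_eq0 negb_or => /andP[hq hr].
exists u; split=> //=; apply: contrapT => nVu.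
by have : (~` V) u by []; rewrite VS => /(_ r Sr) e; rewrite e eqxx in hr.
Qed.

End Zariski.

Unset Implicit Arguments.
Local Open Scope classical_set_scope.
Local Open Scope ring_scope.

Theorem theorem9 (R : realType) (n m : nat)
    (hn : (2 <= n)%N) (hm : (2 * n + 1 <= m)%N) (hnm : coprime n m) :
  exists U : set ('I_(conductor n m - m) -> R[i]),
    [/\ zariski_open U,
        zariski_dense U,
        (forall u, U u -> forall k : 'I_(conductor n m - m),
           nat_of_ord k = 0%N -> u k != 0) &
        forall a : nat -> R[i],
          convergent1 (curve_y m a) ->
          a m != 0 ->
          U (fun k => a (m + k)%N) ->
          legendrian_semigroup n m a = [set l | Gamma n m l]].
Proof.
have n_gt0 : (0 < n)%N by exact: ltnW.
have n_lt_m : (n < m)%N by lia.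
pose N := (conductor n m - m)%N.
pose T := conductor n (m - n).
pose b := @var R[i] N.
pose phi := mono_coef n m N b (@expo_x n m) (@expo_y n m) (@expo_p n m).
pose wt := weight n m (@expo_x n m) (@expo_y n m) (@expo_p n m).
have [d d0 hd] := order_in_specialize wt phi T.
exists [set u | meval u (d * b 0) != 0]; split.
- exact: principal_open.
- by apply: principal_dense; rewrite mulf_neq0 ?var0_neq0.
- move=> u /=; rewrite mevalM mulf_eq0 negb_or => /andP[_ hb] k k0.
  by rewrite -(meval_var u k) k0.
move=> a _ am0 /=; set u := (fun _ => _).
rewrite mevalM mulf_eq0 negb_or => /andP[hdu _].
have GammaE := Gamma_generic (@dvarD R[i] N) (@dvarM _ _) (@dvar_var _ _)
  (var0_neq0 _ _) (@mpoly_char0 _ _) hn n_lt_m hnm erefl.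
have map_phi (B : comNzRingType) (h : {rmorphism mpoly N R[i] -> B}) :
    (fun v k => h (phi v k)) =
    mono_coef n m N (h \o b) (@expo_x n m) (@expo_y n m) (@expo_p n m).
  by apply/funext => v; apply/funext => k; exact: mono_coef_map.
have ub k : (k < N)%N -> meval u (b k) = a (m + k)%N.
  by move=> hk; rewrite (meval_var u (Ordinal hk)).
have below l : (l < T)%N -> legendrian_semigroup n m a l <->
    order_in wt (fun v k => FracField.tofrac (phi v k)) 0 l.
  move=> lt_lT; rewrite (semigroup_below n_gt0 n_lt_m hn ub lt_lT).
  by rewrite -(hd _ (meval u) hdu _ lt_lT) map_phi.
apply/seteqP; split=> l /=; rewrite GammaE; case: (leqP T l) => /= hl //.
- by move=> /(below _ hl); rewrite map_phi => h; apply/asboolP.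
- by move=> _; exact: semigroup_above.
- by move=> /asboolP h; apply/(below _ hl); rewrite map_phi.
Qed.
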